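(* Let $A_1,\ldots,A_m$ be finite subsets of $(\mathbb{Z}_{\ge0})^n$, and let $\mathcal{A}_{[m]}$ be the space of $m$-tuples $(f_1,\ldots,f_m)$ of polynomials in $\mathbb{K}[x_1,\ldots,x_n]$ with $\mathrm{Supp}(f_j)\subseteq A_j$, $1\le j\le m$. Then there is a non-empty Zariski open subset $U$ of $\mathcal{A}_{[m]}$ such that all $(f_1,\ldots,f_m)\in U$ are completely BKK non-degenerate on $\mathbb{K}^n$. In particular, if $m=n$, $\mathcal{P}_j=\mathrm{conv}(A_j)$, $\mathscr{P}=(\mathcal{P}_1,\ldots,\mathcal{P}_n)$, $\Gamma_j$ is the Newton diagram of polynomials with Newton polytope $\mathcal{P}_j$, and $\mathscr{G}=(\Gamma_1,\ldots,\Gamma_n)$, then (for a suitable such $U$): (1) all $(f_1,\ldots,f_n)\in U$ are $\mathscr{P}$-non-degenerate on $\mathbb{K}^n$; (2) if $0<[\Gamma_1,\ldots,\Gamma_n]_0<\infty$, then all $(f_1,\ldots,f_n)\in U$ are $\mathscr{G}$-non-degenerate.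
   Context: $\mathbb{K}$ is an algebraically closed field of arbitrary characteristic, $n\ge1$, $m\ge1$, $[n]=\{1,\ldots,n\}$. $\mathrm{Supp}(f)$ is the set of exponents with non-zero coefficients; the Newton polytope $\mathrm{NP}(f)$ is its convex hull; the Newton diagram is the union of compact faces of $(\mathbb{R}_{\ge0})^n+\mathrm{NP}(f)$. For $I\subseteq[n]$: $\mathbb{K}^I=\{x\in\mathbb{K}^n:x_i=0\text{ for }i\notin I\}$, $(\mathbb{K}^* )^I=\{x\in\mathbb{K}^I:x_i\ne0\text{ for }i\in I\}$, $\mathbb{R}^I$ is defined like $\mathbb{K}^I$, $\mathcal{P}^I=\mathcal{P}\cap\mathbb{R}^I$; $f|_{\mathbb{K}^I}\in\mathbb{K}[x_i:i\in I]$ is $f$ with $x_i=0$ for $i\notin I$. $\mathcal{V}^I$ is the set of monomial valuations on $\mathbb{K}[x_i:i\in I]$, given by integer weights $(\nu_i)_{i\in I}$ that are all zero or have gcd $1$; $\mathrm{In}_\nu(g)$ is the sum of terms of $g$ of minimal $\nu$-weight ($\mathrm{In}_\nu(0)=0$), and $\mathrm{In}_\nu(\mathcal{Q})$ is the face of a polytope $\mathcal{Q}$ on which $\nu$ is minimal. $\mathcal{V}_0^I\subseteq\mathcal{V}^I$ consists of those with all weights positive. $\Omega_\infty^I$ is the set of weighted degrees given by integer weights $(\omega_i)_{i\in I}$ of gcd $1$ with some $\omega_i>0$; $\mathrm{Ld}_\omega(g)$ is the sum of terms of maximal $\omega$-weight ($\mathrm{Ld}_\omega(0)=0$). Polynomials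 $g_1,\ldots,g_r\in\mathbb{K}[x_i:i\in I]$ are completely BKK non-degenerate if for all non-empty $J\subseteq\{1,\ldots,r\}$ and all $\nu\in\mathcal{V}^I$ such that $\dim(\mathrm{In}_\nu(\sum_{j\in J}\mathrm{NP}(g_j)))<|J|$, the polynomials $\mathrm{In}_\nu(g_j)$, $j\in J$, have no common zero in $(\mathbb{K}^* )^n$. $f_1,\ldots,f_m$ are completely BKK non-degenerate on $\mathbb{K}^n$ if for every non-empty $I\subseteq[n]$, the collection $\{f_j|_{\mathbb{K}^I}:f_j|_{\mathbb{K}^I}\not\equiv0\}$ is completely BKK non-degenerate. $[\Gamma_1,\ldots,\Gamma_n]_0$ is the minimum of $\dim_{\mathbb{K}}\mathbb{K}[[x_1,\ldots,x_n]]/\langle g_1,\ldots,g_n\rangle$ over polynomials $g_1,\ldots,g_n$ with Newton diagrams $\Gamma_1,\ldots,\Gamma_n$. $f_1,\ldots,f_n$ are $\mathscr{G}$-non-degenerate (defined when $[\Gamma_1,\ldots,\Gamma_n]_0<\infty$) if the Newton diagram of $f_j$ is $\Gamma_j$ for all $j$ and for every non-empty $I\subseteq[n]$ and $\nu\in\mathcal{V}_0^I$, $\mathrm{In}_\nu(f_1|_{\mathbb{K}^I}),\ldots,\mathrm{In}_\nu(f_n|_{\mathbb{K}^I})$ have no common zero in $(\mathbb{K}^* )^n$. $\mathscr{P}$-non-degeneracy on $\mathbb{K}^n$: $f_1,\ldots,f_n$ are $\mathscr{P}$-admissible if $\mathrm{NP}(f_j)=\mathcal{P}_j$ for all $j$.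 $\mathscr{P}$ is $(\mathbb{K}^* )^I$-trivial if $V(g_1,\ldots,g_n)\cap(\mathbb{K}^* )^I=\emptyset$ for generic $\mathscr{P}$-admissible $g_1,\ldots,g_n$. $\mathcal{N}^I_{\mathscr{P}}=\{j:\mathcal{P}_j^I\ne\emptyset\}$; $\mathcal{E}_{\mathscr{P}}=\{I\subseteq[n]:\text{there is }\tilde I\supseteq I\text{ with }|\mathcal{N}^{\tilde I}_{\mathscr{P}}|<|\tilde I|\}$. $\mathscr{P}$ is $(\mathbb{K}^* )^I$-exotrivial if either $I\in\mathcal{E}_{\mathscr{P}}$, or $\mathscr{P}$ is $(\mathbb{K}^* )^I$-trivial and there is $\tilde I\supseteq I$ such that $\mathscr{P}$ is $(\mathbb{K}^* )^{\tilde I}$-trivial, $|\mathcal{N}^{\tilde I}_{\mathscr{P}}|=|\tilde I|$, and $|\mathcal{N}^{I^*}_{\mathscr{P}}|>|I^*|$ whenever $I\subseteq I^*\subsetneq\tilde I$. Let $\mathcal{T}$ (resp. $\mathcal{T}'$) be the set of $I\subseteq[n]$ such that $I\notin\mathcal{E}_{\mathscr{P}}$ and $\mathscr{P}$ is (resp. is not) $(\mathbb{K}^* )^I$-exotrivial. For a collection $\mathscr{R}$ of subsets of $[n]$, $\mathscr{R}^I=\{S\in\mathscr{R}:S\subseteq I\}$. Polynomials $g_1,\ldots,g_n\in\mathbb{K}[x_i:i\in I]$ are BKK non-degenerate at infinity if $\mathrm{Ld}_\omega(g_1),\ldots,\mathrm{Ld}_\omega(g_n)$ have no common zero in $(\mathbb{K}^*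 )^n$ for all $\omega\in\Omega_\infty^I$; they are BKK non-degenerate at $\mathscr{R}^I$ if $\mathrm{In}_\nu(g_1),\ldots,\mathrm{In}_\nu(g_n)$ have no common zero in $(\mathbb{K}^* )^n$ for every $\nu\in\mathcal{V}^I$ for which there is $S\in\mathscr{R}^I$ with $\nu_s=0$ for $s\in S$ and $\nu_s>0$ for $s\in I\setminus S$. Then $f_1,\ldots,f_n$ are $\mathscr{P}$-non-degenerate on $\mathbb{K}^n$ if they are $\mathscr{P}$-admissible; for all $I\in\mathcal{T}'$, $f_1|_{\mathbb{K}^I},\ldots,f_n|_{\mathbb{K}^I}$ are BKK non-degenerate at infinity and at $\mathcal{T}^I$; and for all $I\in\mathcal{T}$, $f_1|_{\mathbb{K}^I},\ldots,f_n|_{\mathbb{K}^I}$ are BKK non-degenerate at $\mathcal{T}'^I$. *)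

(* Defs.v *)
From HB Require Import structures.
From mathcomp Require Import all_boot all_order all_algebra finmap.
From mathcomp Require Import mpoly.
From mathcomp Require Import boolp classical_sets reals topology.

Set Implicit Arguments.
Unset Strict Implicit.
Unset Printing Implicit Defensive.

Import Order.TTheory GRing.Theory Num.Theory.
Import numFieldTopology.Exports.

Local Open Scope classical_set_scope.
Local Open Scope ring_scope.

Definition exponent (R : realType) (n : nat) (a : 'X_{1..n}) : 'rV[R]_n :=
  \row_i (a i)%:R.
Arguments exponent R {n} a.

Definition convex_hull (R : realType) (n : nat) (S : set 'rV[R]_n) :
    set 'rV[R]_n :=
  [set x | exists (k : nat) (p : 'I_k -> 'rV[R]_n) (l : 'I_k -> R),
    [/\ forall i, S (p i), forall i, 0 <= l i, \sum_i l i = 1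
      & x = \sum_i l i *: p i]].

Definition dot (R : realType) (n : nat) (u v : 'rV[R]_n) : R :=
  \sum_i u 0 i * v 0 i.

Definition face (R : realType) (n : nat) (u : 'rV[R]_n) (Q : set 'rV[R]_n) :
    set 'rV[R]_n :=
  [set x | Q x /\ forall y, Q y -> dot u x <= dot u y].

Definition minkowski_sum (R : realType) (n : nat) (T : finType) (J : {set T})
    (Q : T -> set 'rV[R]_n) : set 'rV[R]_n :=
  [set x | exists2 y : T -> 'rV[R]_n,
    (forall j, j \in J -> Q j (y j)) & x = \sum_(j in J) y j].

(* Dimension of the affine hull: the largest d such that S contains d + 1
   affinely independent points.  The empty set gets 0 instead of -1; since
   [affdim] is only compared with cardinals of non-empty sets, by
   [affdim S < #|J|], this changes nothing. *)
Definition affdim (R : realType) (n : nat) (S : set 'rV[R]_n) : nat :=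
  (\max_(d < n.+1 | `[< exists (x0 : 'rV[R]_n) (M : 'M[R]_(d, n)),
      [/\ S x0, forall i, S (x0 + row i M)%R & row_free M] >]) d)%N.

Definition coord_space (R : realType) (n : nat) (I : {set 'I_n}) :
    set 'rV[R]_n :=
  [set x | forall i, i \notin I -> x 0 i = 0].
Arguments coord_space R {n} I.

Definition orthant (R : realType) (n : nat) : set 'rV[R]_n :=
  [set x | forall i, 0 <= x 0 i].
Arguments orthant R n : clear implicits.

Definition diagram_of_polytope (R : realType) (n : nat) (P : set 'rV[R]_n) :
    set 'rV[R]_n :=
  [set x | exists u : 'rV[R]_n,
    let F := face u [set y + z | y in orthant R n & z in P] in
    compact F /\ F x].

Definition newton_polytope (R : realType) (K : closedFieldType) (n : nat)
    (f : {mpoly K[n]}) : set 'rV[R]_n :=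
  convex_hull (exponent R @` [set a | a \in msupp f]).
Arguments newton_polytope R {K n} f.

Definition newton_diagram (R : realType) (K : closedFieldType) (n : nat)
    (f : {mpoly K[n]}) : set 'rV[R]_n :=
  diagram_of_polytope (newton_polytope R f).
Arguments newton_diagram R {K n} f.

(* f|_{K^I}.  The ring K[x_i : i \in I] is viewed inside K[x_1, ..., x_n]. *)
Definition restr (K : closedFieldType) (n : nat) (I : {set 'I_n})
    (f : {mpoly K[n]}) : {mpoly K[n]} :=
  f \mPo [tuple (if i \in I then 'X_i else 0) | i < n].

(* Integer weights (w_i)_{i \in I} are vectors of Z^n that vanish outside I,
   in line with R^I and K^I being coordinate subspaces.  In this encoding
   V^I, V_0^I and Omega_oo^I are [valuation I], [centered_valuation I] and
   [degree_at_infinity I]. *)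
Definition weight_on (n : nat) (I : {set 'I_n}) (w : 'rV[int]_n) : Prop :=
  forall i, i \notin I -> w 0 i = 0.

Definition weight_gcd (n : nat) (w : 'rV[int]_n) : nat :=
  (\big[gcdn/0]_i `|w 0%R i|)%N.

Definition valuation (n : nat) (I : {set 'I_n}) (v : 'rV[int]_n) : Prop :=
  weight_on I v /\ (v = 0 \/ weight_gcd v = 1%N).

Definition centered_valuation (n : nat) (I : {set 'I_n}) (v : 'rV[int]_n) :
    Prop :=
  valuation I v /\ forall i, i \in I -> 0 < v 0 i.

Definition degree_at_infinity (n : nat) (I : {set 'I_n}) (w : 'rV[int]_n) :
    Prop :=
  [/\ weight_on I w, weight_gcd w = 1%N & exists2 i, i \in I & 0 < w 0 i].

Definition weight (n : nat) (w : 'rV[int]_n) (a : 'X_{1..n}) : int :=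
  \sum_i w 0 i * (a i)%:Z.

Definition initial_form (K : closedFieldType) (n : nat) (v : 'rV[int]_n)
    (g : {mpoly K[n]}) : {mpoly K[n]} :=
  \sum_(a <- msupp g | all (fun b => weight v a <= weight v b) (msupp g))
    g@_a *: 'X_[a].

Definition leading_form (K : closedFieldType) (n : nat) (w : 'rV[int]_n)
    (g : {mpoly K[n]}) : {mpoly K[n]} :=
  \sum_(a <- msupp g | all (fun b => weight w b <= weight w a) (msupp g))
    g@_a *: 'X_[a].

Definition torus (K : closedFieldType) (n : nat) (I : {set 'I_n}) :
    set ('I_n -> K) :=
  [set x : 'I_n -> K | forall i, (x i != 0) = (i \in I)].

Definition common_zero_on (K : closedFieldType) (n : nat) (I : {set 'I_n})
    (T : finType) (J : {set T}) (g : T -> {mpoly K[n]}) : Prop :=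
  exists2 x : 'I_n -> K, torus I x & forall j, j \in J -> (g j).@[x] = 0.

Definition completely_BKK (R : realType) (K : closedFieldType) (n : nat)
    (I : {set 'I_n}) (T : finType) (g : T -> {mpoly K[n]}) : Prop :=
  forall (J : {set T}) (v : 'rV[int]_n),
    (0 < #|J|)%N -> valuation I v ->
    (affdim (face (map_mx intr v)
               (minkowski_sum J (fun j => newton_polytope R (g j))))
      < #|J|)%N ->
    ~ common_zero_on [set: 'I_n]%SET J (fun j => initial_form v (g j)).

Definition completely_BKK_on_affine (R : realType) (K : closedFieldType)
    (n m : nat) (f : 'I_m -> {mpoly K[n]}) : Prop :=
  forall I : {set 'I_n}, (0 < #|I|)%N ->
    completely_BKK R I
      (fun j : {j : 'I_m | restr I (f j) != 0} => restr I (f (val j))).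

Definition BKK_at_infinity (K : closedFieldType) (n : nat) (I : {set 'I_n})
    (g : 'I_n -> {mpoly K[n]}) : Prop :=
  forall w : 'rV[int]_n, degree_at_infinity I w ->
    ~ common_zero_on [set: 'I_n]%SET [set: 'I_n]%SET
        (fun j => leading_form w (g j)).

(* BKK non-degeneracy at C^I, the members of the collection C contained in I *)
Definition BKK_at (K : closedFieldType) (n : nat) (C : set {set 'I_n})
    (I : {set 'I_n}) (g : 'I_n -> {mpoly K[n]}) : Prop :=
  forall v : 'rV[int]_n, valuation I v ->
    (exists S : {set 'I_n},
      [/\ C S, S \subset I, forall s, s \in S -> v 0 s = 0
        & forall s, s \in I -> s \notin S -> 0 < v 0 s]) ->
    ~ common_zero_on [set: 'I_n]%SET [set: 'I_n]%SET
        (fun j => initial_form v (g j)).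

Definition supported_in (K : closedFieldType) (n m : nat)
    (A : 'I_m -> {fset 'X_{1..n}}) : set ('I_m -> {mpoly K[n]}) :=
  [set f | forall j, {subset msupp (f j) <= A j}].

Definition coef_index (n m : nat) (A : 'I_m -> {fset 'X_{1..n}}) : finType :=
  {j : 'I_m & A j}.

(* The coefficients of f identify [supported_in A] with an affine space. *)
Definition coefs (K : closedFieldType) (n m : nat)
    (A : 'I_m -> {fset 'X_{1..n}}) (f : 'I_m -> {mpoly K[n]}) :
    'I_#|coef_index A| -> K :=
  fun i => (f (tag (enum_val i)))@_(val (tagged (enum_val i))).
Arguments coefs {K n m} A f i.

Definition zariski_open (K : closedFieldType) (n m : nat)
    (A : 'I_m -> {fset 'X_{1..n}}) (U : set ('I_m -> {mpoly K[n]})) : Prop :=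
  exists S : set {mpoly K[#|coef_index A|]},
    U = [set f | supported_in A f /\ exists2 p, S p & p.@[coefs A f] != 0].

Definition admissible (R : realType) (K : closedFieldType) (n : nat)
    (P : 'I_n -> set 'rV[R]_n) (f : 'I_n -> {mpoly K[n]}) : Prop :=
  forall j, newton_polytope R (f j) = P j.

(* "Generic" refers to the affine space of tuples (g_1, ..., g_n) such that
   Supp(g_j) is contained in the finite set B_j of lattice points of P_j. *)
Definition torus_trivial (R : realType) (K : closedFieldType) (n : nat)
    (P : 'I_n -> set 'rV[R]_n) (I : {set 'I_n}) : Prop :=
  exists2 B : 'I_n -> {fset 'X_{1..n}},
    (forall j a, (a \in B j) <-> P j (exponent R a))
  & exists U : set ('I_n -> {mpoly K[n]}),
    [/\ zariski_open B U, U !=set0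
      & forall g, U g -> admissible P g ->
          ~ common_zero_on I [set: 'I_n]%SET g].

Definition nonempty_at (R : realType) (n : nat) (P : 'I_n -> set 'rV[R]_n)
    (I : {set 'I_n}) : {set 'I_n} :=
  [set j | `[< P j `&` coord_space R I !=set0 >]]%SET.

Definition exceptional (R : realType) (n : nat) (P : 'I_n -> set 'rV[R]_n) :
    set {set 'I_n} :=
  [set I | exists2 I' : {set 'I_n},
    I \subset I' & (#|nonempty_at P I'| < #|I'|)%N].

Definition exotrivial (R : realType) (K : closedFieldType) (n : nat)
    (P : 'I_n -> set 'rV[R]_n) (I : {set 'I_n}) : Prop :=
  exceptional P I \/
  (torus_trivial K P I /\
   exists I' : {set 'I_n},
     [/\ I \subset I', torus_trivial K P I', #|nonempty_at P I'| = #|I'|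
       & forall J : {set 'I_n}, I \subset J -> J \proper I' ->
           (#|J| < #|nonempty_at P J|)%N]).

Definition exotrivial_sets (R : realType) (K : closedFieldType) (n : nat)
    (P : 'I_n -> set 'rV[R]_n) : set {set 'I_n} :=
  [set I | ~ exceptional P I /\ exotrivial K P I].

Definition non_exotrivial_sets (R : realType) (K : closedFieldType) (n : nat)
    (P : 'I_n -> set 'rV[R]_n) : set {set 'I_n} :=
  [set I | ~ exceptional P I /\ ~ exotrivial K P I].

Definition polytope_nondegenerate (R : realType) (K : closedFieldType)
    (n : nat) (P : 'I_n -> set 'rV[R]_n) (f : 'I_n -> {mpoly K[n]}) : Prop :=
  [/\ admissible P f,
      forall I, non_exotrivial_sets K P I ->
        BKK_at_infinity I (fun j => restr I (f j)) /\
        BKK_at (exotrivial_sets K P) I (fun j => restr I (f j))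
    & forall I, exotrivial_sets K P I ->
        BKK_at (non_exotrivial_sets K P) I (fun j => restr I (f j))].

Definition power_series (K : closedFieldType) (n : nat) : Type :=
  'X_{1..n} -> K.

(* Cauchy product; the bounds on the degrees only make the sum finite, cf.
   [mcoeffM]. *)
Definition ps_mul (K : closedFieldType) (n : nat) (p q : power_series K n) :
    power_series K n :=
  fun a => \sum_(k : 'X_{1..n < (mdeg a).+1, (mdeg a).+1}
                  | a == (k.1 + k.2)%MM) p k.1 * q k.2.

Definition ps_ideal (K : closedFieldType) (n r : nat)
    (g : 'I_r -> {mpoly K[n]}) : set (power_series K n) :=
  [set p | exists h : 'I_r -> power_series K n,
    forall a, p a = \sum_j ps_mul (h j) (fun b => (g j)@_b) a].

(* dim_K K[[x_1, ..., x_n]] / <g_1, ..., g_r> = d; it is infinite when this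
   holds for no d. *)
Definition ps_quotient_dim (K : closedFieldType) (n r : nat)
    (g : 'I_r -> {mpoly K[n]}) (d : nat) : Prop :=
  exists b : 'I_d -> power_series K n,
    (forall c : 'I_d -> K,
       ps_ideal g (fun a => \sum_i c i * b i a) -> forall i, c i = 0) /\
    (forall p : power_series K n, exists c : 'I_d -> K,
       ps_ideal g (fun a => p a - \sum_i c i * b i a)).

(* [Gamma_1, ..., Gamma_n]_0 = d; it is infinite when this holds for no d. *)
Definition diagram_mult (R : realType) (K : closedFieldType) (n : nat)
    (G : 'I_n -> set 'rV[R]_n) (d : nat) : Prop :=
  (exists2 g : 'I_n -> {mpoly K[n]},
     (forall j, newton_diagram R (g j) = G j) & ps_quotient_dim g d) /\
  (forall (g : 'I_n -> {mpoly K[n]}) (d' : nat),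
     (forall j, newton_diagram R (g j) = G j) -> ps_quotient_dim g d' ->
     (d <= d')%N).

Definition diagram_nondegenerate (R : realType) (K : closedFieldType)
    (n : nat) (G : 'I_n -> set 'rV[R]_n) (f : 'I_n -> {mpoly K[n]}) : Prop :=
  (forall j, newton_diagram R (f j) = G j) /\
  forall (I : {set 'I_n}) (v : 'rV[int]_n),
    (0 < #|I|)%N -> centered_valuation I v ->
    ~ common_zero_on [set: 'I_n]%SET [set: 'I_n]%SET
        (fun j => initial_form v (restr I (f j))).

(* Main.v *)
Require Import Defs.
From mathcomp Require Import all_boot all_order all_algebra finmap.
From mathcomp Require Import mpoly.
From mathcomp Require Import boolp classical_sets reals topology.

Set Implicit Arguments.
Unset Strict Implicit.
Unset Printing Implicit Defensive.

Import Order.TTheory GRing.Theory Num.Theory.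

Local Open Scope classical_set_scope.
Local Open Scope ring_scope.

(** Every non-degeneracy condition considered here says that certain partial sums
    of the polynomials f_j have no common zero on a torus, and a dimension count
    shows that too many equations in too few parameters have none generically.

    Let J be a set of indices and, for j in J, let B_j be a non-empty set of
    exponents of f_j, such that all differences of two exponents in a common B_j
    lie in a space of dimension d < |J|.  Dividing the j-th partial sum by one of
    its monomials leaves an expression in d monomials s_1, ..., s_d, up to roots
    ([monomial_parametrization]).  The j-th equation then expresses one coefficient
    through the s_l and the other coefficients, so the coefficient vectors that
    admit a common zero are images of points with N - |J| + d < N coordinates, N
    being the number of all coefficients.  As N polynomials in fewer than N
    variables are algebraically dependent ([algebraic_relation], by counting
    monomials), these vectors lie on a hypersurface ([overdetermined_resultant]).
    There are finitely many choices of J and of the B_j; the complement of their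
    hypersurfaces and of the coordinate hyperplanes is a non-empty open set of
    tuples with full supports ([exists_nondegenerate_open]).  The argument works in
    every characteristic, since it never differentiates.

    Such tuples have all the required properties.  For complete BKK
    non-degeneracy, B_j is the set of exponents of minimal weight in a restriction
    of f_j, and the face of the Minkowski sum contains translates of one of its
    points by a spanning set of the differences ([initial_directions]).  If the
    weight is non-zero and lives on I, the differences lie in a hyperplane of the
    coordinate space of I, so it is enough that at least |I| of the restrictions
    f_j|I are non-zero ([nonzero_weight_no_zero]).

    In the definition of non-degeneracy with respect to the polytopes, this count
    is what it means for I not to be exceptional, and the weights in question are
    non-zero because a non-exotrivial set differs from an exotrivial one.  For the
    Newton diagrams, some g_1, ..., g_n with the same diagrams generate a proper
    ideal of finite codimension in the power series ring.  Krull's height theorem,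
    again proved by counting monomials, bounds |I| by the number of non-zero g_j|I
    ([leq_card_nonzero_restr]), and the diagrams show that f_j|I is non-zero
    whenever g_j|I is ([dominant_face] and [diagram_coord_space]). *)

(** * Algebraic dependence by counting monomials *)

(** Growth comparison behind both dimension counts: the exponent wins over the
    constants [c] and [d]. *)
Lemma exists_expn_gt (k s c d : nat) : (s < k)%N ->
  exists2 e : nat, (0 < e)%N & (d * (e * c) ^ s < e ^ k)%N.
Proof.
move=> lt_sk; exists (d * c ^ s).+1 => //.
set e := (d * c ^ s).+1.
apply: (@leq_trans (e ^ s.+1)); last by rewrite leq_pexp2l.
by rewrite expnMn mulnCA expnSr ltn_pmul2l ?expn_gt0.
Qed.

Lemma linear_relation (K : fieldType) (S T : finType) (a : T -> S -> K) :
  (#|S| < #|T|)%N ->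
  exists2 c : T -> K, (exists t, c t != 0) & forall s, \sum_t c t * a t s = 0.
Proof.
move=> lt_ST.
pose A := \matrix_(i < #|T|, j < #|S|) a (enum_val i) (enum_val j).
have [v /sub_kermxP vA0 nz_v] : exists2 v : 'rV_#|T|, (v <= kermx A)%MS & v != 0.
  apply/rowV0Pn; rewrite -mxrank_eq0 mxrank_ker subn_eq0 -ltnNge.
  exact: leq_ltn_trans (rank_leq_col A) lt_ST.
exists (fun t => v 0 (enum_rank t)).
  by have [j nz] := rV0Pn _ nz_v; exists (enum_val j); rewrite enum_valK.
move=> s; have /rowP/(_ (enum_rank s)) := vA0.
rewrite !mxE => {2}<-; rewrite (reindex_onto enum_val enum_rank) /=; last first.
  by move=> t _; rewrite enum_rankK.
by apply: eq_big => i; rewrite enum_valK ?eqxx // => _; rewrite !mxE enum_rankK.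
Qed.

Definition box_mnm (n k : nat) (e : {ffun 'I_n -> 'I_k}) : 'X_{1..n} :=
  [multinom val (e i) | i < n].

Lemma box_mnmP (n k : nat) (m : 'X_{1..n}) :
  (forall i, m i < k)%N -> exists e : {ffun 'I_n -> 'I_k}, m = box_mnm e.
Proof.
move=> lt_mk; exists [ffun i => Ordinal (lt_mk i)].
by apply/mnmP => i; rewrite mnmE ffunE.
Qed.

Lemma box_mnm_inj (n k : nat) : injective (@box_mnm n k).
Proof.
move=> e e' /mnmP eq_ee'; apply/ffunP => i; apply: val_inj.
by have := eq_ee' i; rewrite !mnmE.
Qed.

Lemma mnm_le_mdeg (n : nat) (m : 'X_{1..n}) (i : 'I_n) : (m i <= mdeg m)%N.
Proof. by rewrite mdegE (bigD1 i) //= leq_addr. Qed.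

Lemma msize_mul_le (R : idomainType) (n : nat) (p q : {mpoly R[n]}) (s t : nat) :
  (msize p <= s.+1)%N -> (msize q <= t.+1)%N -> (msize (p * q) <= (s + t).+1)%N.
Proof.
move=> le_s le_t.
have [->|nz_p] := eqVneq p 0; first by rewrite mul0r msize0.
have [->|nz_q] := eqVneq q 0; first by rewrite mulr0 msize0.
by rewrite msizeM // -subn1 leq_subLR add1n -addnS -addSn leq_add.
Qed.

Lemma msize_prod_le (R : idomainType) (n : nat) (T : Type) (r : seq T)
    (F : T -> {mpoly R[n]}) (s : T -> nat) :
  (forall t, msize (F t) <= (s t).+1)%N ->
  (msize (\prod_(t <- r) F t)%R <= (\sum_(t <- r) s t).+1)%N.
Proof.
move=> le_s; elim/big_rec2: _ => [|t y p _ le_py]; first by rewrite msize1.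
exact: msize_mul_le.
Qed.

Lemma msize_exp_le (R : idomainType) (n : nat) (p : {mpoly R[n]}) (s e : nat) :
  (msize p <= s.+1)%N -> (msize (p ^+ e) <= (s * e).+1)%N.
Proof.
move=> le_s; elim: e => [|e IHe]; first by rewrite expr0 msize1.
by rewrite exprS mulnS msize_mul_le.
Qed.

(** The products of powers of the [F i] with exponents below [D] number D^N, while
    their degrees are linear in [D], so that they lie in a space of dimension
    O(D^M). *)
Lemma algebraic_relation (K : fieldType) (M N : nat)
    (F : N.-tuple {mpoly K[M]}) : (M < N)%N ->
  exists2 p : {mpoly K[N]}, p != 0 & p \mPo F = 0.
Proof.
move=> lt_MN; pose s := \max_i msize (tnth F i).
have [D D_gt0] := @exists_expn_gt N M (N * s).+1 1 lt_MN; rewrite mul1n => ltL.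
pose L := (D * (N * s).+1)%N.
pose G (e : {ffun 'I_N -> 'I_D}) := \prod_i tnth F i ^+ e i.
have size_G e : (msize (G e) <= L)%N.
  apply: leq_trans (msize_prod_le _ (s := fun i => (s * D)%N) _) _.
    move=> i; rewrite (leq_trans (msize_exp_le (s := s) _ _)) //.
      by rewrite (leq_trans _ (leqnSn _)) // leq_bigmax_cond.
    by rewrite ltnS leq_mul2l ltnW ?ltn_ord ?orbT.
  rewrite sum_nat_const card_ord mulnA mulnC /L mulnS -addn1 addnC.
  by rewrite leq_add2r.
have [|c [e0 nz_c] c0] := @linear_relation K {ffun 'I_M -> 'I_L}
    {ffun 'I_N -> 'I_D} (fun e a => (G e)@_(box_mnm a)).
  by rewrite !card_ffun !card_ord.
exists (\sum_e c e *: 'X_[box_mnm e]).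
  apply: contra nz_c => /eqP/mpolyP/(_ (box_mnm e0)).
  rewrite raddf_sum mcoeff0 (bigD1 e0) //= mcoeffZ mcoeffX eqxx mulr1.
  rewrite big1 ?addr0 => [->//|e ne_e].
  by rewrite mcoeffZ mcoeffX (inj_eq (@box_mnm_inj _ _)) (negPf ne_e) mulr0.
rewrite raddf_sum /=; apply/mpolyP => m; rewrite raddf_sum mcoeff0 /=.
have GE e : (c e *: 'X_[box_mnm e]) \mPo F = c e *: G e.
  rewrite comp_mpolyZ comp_mpolyX; congr (_ *: _).
  by apply: eq_bigr => i _; rewrite mnmE.
under eq_bigr do rewrite GE mcoeffZ.
have [lt_mL|le_Lm] := ltnP (mdeg m) L.
  have [|a ->] := @box_mnmP M L m; last exact: c0.
  by move=> i; apply: leq_ltn_trans lt_mL; apply: mnm_le_mdeg.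
rewrite big1 // => e _; rewrite (memN_msupp_eq0 _) ?mulr0 //.
by apply: msize_mdeg_ge; apply: leq_trans le_Lm.
Qed.

Lemma digits_lt (n T : nat) (a : 'I_n -> nat) :
  (forall i, a i < T)%N -> (\sum_i a i * T ^ i < T ^ n)%N.
Proof.
elim: n a => [|n IHn] a lt_aT; first by rewrite big_ord0.
rewrite big_ord_recr /=.
have := IHn (fun i => a (widen_ord (leqnSn n) i)) (fun i => lt_aT _) => /= ltn.
rewrite -(ltn_add2r (a ord_max * T ^ n)) in ltn.
by rewrite (leq_trans ltn) // -mulSn expnS leq_mul2r lt_aT orbT.
Qed.

Lemma digits_inj (n T : nat) (a b : 'I_n -> nat) :
  (forall i, a i < T)%N -> (forall i, b i < T)%N ->
  (\sum_i a i * T ^ i = \sum_i b i * T ^ i)%N -> a =1 b.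
Proof.
elim: n a b => [|n IHn] a b lt_aT lt_bT; first by move=> _ [].
rewrite !big_ord_recr /=.
have ltn_a := @digits_lt n T (fun i => a (widen_ord (leqnSn n) i)) (fun i => lt_aT _).
have ltn_b := @digits_lt n T (fun i => b (widen_ord (leqnSn n) i)) (fun i => lt_bT _).
set x := (\sum_(i < n) _)%N in ltn_a *; set y := (\sum_(i < n) _)%N in ltn_b *.
move=> eq_ab.
have Tn_gt0 : (0 < T ^ n)%N by apply: leq_ltn_trans ltn_a.
have eq_max : a ord_max = b ord_max.
  have := congr1 (fun z => z %/ T ^ n)%N eq_ab.
  by rewrite ![(_ + _ * _)%N]addnC !divnMDl // !divn_small // !addn0.
have /IHn eq_low : x = y by move: eq_ab; rewrite eq_max; apply: addIn.
move=> i; have [lt_in|] := ltnP i n.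
  have -> : i = widen_ord (leqnSn n) (Ordinal lt_in) by apply: val_inj.
  by apply: (eq_low).
by move=> le_ni; have -> : i = ord_max by apply: val_inj;
  apply/eqP; rewrite eqn_leq le_ni -ltnS ltn_ord.
Qed.

(** A closed field is infinite for a simple reason: a root of [q - 1], which
    exists unless [q] is constant, is not a root of [q]. *)
Lemma closed_field_nonroot (K : closedFieldType) (q : {poly K}) :
  q != 0 -> exists x, q.[x] != 0.
Proof.
move=> nz_q; have [s1|/closed_rootP[x rx]] := eqVneq (size (q - 1)) 1%N.
  have /size_poly1P[c _ qc] : size (q - 1) == 1%N by rewrite s1.
  have qE : q = (c + 1)%:P by rewrite polyCD -qc subrK.
  by exists 0; rewrite qE hornerC; apply: contra nz_q; rewrite qE => /eqP->.
by exists x; move: rx; rewrite rootE !hornerE subr_eq0 => /eqP->; apply: oner_neq0.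
Qed.

(** Kronecker's substitution of X^(T^i) for the i-th variable keeps distinct
    exponents distinct when [T] exceeds the degree, by uniqueness of the digits in
    base [T]. *)
Lemma mpoly_nonroot (K : closedFieldType) (n : nat) (p : {mpoly K[n]}) :
  p != 0 -> exists x : 'I_n -> K, p.@[x] != 0.
Proof.
move=> nz_p; pose T := msize p.
pose wt (m : 'X_{1..n}) := (\sum_(i < n) m i * T ^ i)%N.
have wt_inj : {in msupp p &, injective wt}.
  move=> a b pa pb eq_ab; apply/mnmP; apply: digits_inj eq_ab => i.
    exact: leq_ltn_trans (mnm_le_mdeg _ _) (msize_mdeg_lt pa).
  exact: leq_ltn_trans (mnm_le_mdeg _ _) (msize_mdeg_lt pb).
(* [q] is the result of the substitution. *)
pose q : {poly K} := \sum_(m <- msupp p) p@_m *: 'X^(wt m).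
have [a pa] : exists a, a \in msupp p.
  have := nz_p; rewrite -msupp_eq0; case: (msupp p) => // a s _.
  by exists a; rewrite mem_head.
have nz_q : q != 0.
  apply/eqP => /polyP/(_ (wt a)); rewrite coef0 coef_sum.
  rewrite (bigD1_seq a) ?msupp_uniq //= coefZ coefXn eqxx mulr1 big_seq_cond.
  rewrite big1 ?addr0 => [/eqP|b /andP[pb ne_ba]].
    by rewrite mcoeff_eq0 pa.
  rewrite coefZ coefXn; case: eqP => [/wt_inj eq_ab|]; last by rewrite mulr0.
  by rewrite eq_ab ?eqxx in ne_ba.
have [x nz_qx] := closed_field_nonroot nz_q.
exists (fun i => x ^+ (T ^ i)); congr (_ != 0): nz_qx.
rewrite mevalE horner_sum; apply: eq_bigr => m _; rewrite hornerZ hornerXn.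
by congr (_ * _); rewrite expr_sum; apply: eq_bigr => i _; rewrite -exprM mulnC.
Qed.

(** * Overdetermined systems of sparse equations *)

Lemma common_denominator (I : finType) (q : I -> rat) :
  exists2 m : nat, (0 < m)%N &
    exists z : I -> int, forall i, m%:R * q i = (z i)%:~R.
Proof.
pose m := \prod_i denq (q i).
have m_gt0 : 0 < m by apply: prodr_gt0 => i _; apply: denq_gt0.
exists `|m|%N; first by rewrite absz_gt0 gt_eqF.
exists (fun i => (\prod_(k | k != i) denq (q k)) * numq (q i)) => i.
rewrite -[_%:R]/((`|m|%N%:Z)%:~R) gez0_abs ?ltW // /m (bigD1 i) //= !intrM.
by rewrite numqE [in RHS]mulrA [RHS]mulrC mulrA.
Qed.

Definition rat_exponent (n : nat) (a : 'X_{1..n}) : 'rV[rat]_n :=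
  \row_i (a i)%:R.

Definition mon (K : closedFieldType) (n : nat) (x : 'I_n -> K) (a : 'X_{1..n}) : K :=
  \prod_i x i ^+ a i.

Lemma mon_neq0 (K : closedFieldType) (n : nat) (x : 'I_n -> K) a :
  (forall i, x i != 0) -> mon x a != 0.
Proof. by move=> nz_x; apply/prodf_neq0 => i _; rewrite expf_neq0. Qed.

Lemma closed_field_nth_root (K : closedFieldType) (m : nat) (x : K) :
  (0 < m)%N -> exists y, y ^+ m = x.
Proof.
move=> m_gt0; have /closed_rootP[y] : size ('X^m - x%:P) != 1%N.
  by rewrite size_XnsubC // eqSS -lt0n.
by rewrite rootE !hornerE subr_eq0 => /eqP; exists y.
Qed.

(** The differences of exponents are rational combinations of a basis of [D].  After
    clearing denominators they become integral ones, at the price of replacing [x]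
    by a root [y]; the [s l] are the monomials in [y] given by the basis.  The
    number of parameters is the rank of [D], whereas the exponents [z] do not
    depend on [x]. *)
Lemma monomial_parametrization (K : closedFieldType) (n q : nat) (I : finType)
    (B : {set I}) (a b : I -> 'X_{1..n}) (D : 'M[rat]_(q, n)) :
  (forall r, r \in B -> (rat_exponent (a r) - rat_exponent (b r) <= D)%MS) ->
  exists z : I -> 'I_(\rank D) -> int,
  forall x : 'I_n -> K, (forall i, x i != 0) ->
  exists2 s : 'I_(\rank D) -> K, (forall l, s l != 0) &
    forall r, r \in B -> mon x (a r) = mon x (b r) * \prod_l s l ^ z r l.
Proof.
move=> subD; set d := \rank D.
have /choice[u uP] : forall r, exists u : 'rV[rat]_d, r \in B ->
    rat_exponent (a r) - rat_exponent (b r) = u *m row_base D.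
  move=> r; case: (boolP (r \in B)) => [/subD|_]; last by exists 0.
  by rewrite -(eq_row_base D) => /submxP[u ->]; exists u.
have [m1 m1_gt0 [z zP]] := common_denominator (fun rl : I * 'I_d => u rl.1 0 rl.2).
have [m2 m2_gt0 [w wP]] :=
  common_denominator (fun li : 'I_d * 'I_n => row_base D li.1 li.2).
exists (fun r l => z (r, l)) => x nz_x.
have /choice[y yP] i : exists y, y ^+ (m1 * m2) = x i.
  by apply: closed_field_nth_root; rewrite muln_gt0 m1_gt0.
have nz_y i : y i != 0.
  by apply: contra_neq (nz_x i); rewrite -yP => ->;
     rewrite expr0n gtn_eqF // muln_gt0 m1_gt0.
exists (fun l => \prod_i y i ^ w (l, i)) => [l|r rB].
  by apply/prodf_neq0 => i _; rewrite expfz_neq0.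
have key i : ((m1 * m2) * a r i)%N%:Z
    = ((m1 * m2) * b r i)%N%:Z + \sum_l z (r, l) * w (l, i).
  apply: (@intr_inj rat); rewrite intrD rmorph_sum /=.
  have /rowP/(_ i) := uP r rB; rewrite !mxE => /eqP; rewrite subr_eq addrC => /eqP aE.
  rewrite -!pmulrn !natrM aE mulrDr mulr_sumr; congr (_ + _).
  apply: eq_bigr => l _; rewrite intrM -(zP (r, l)) -(wP (l, i)) /=.
  by rewrite -!mulrA; congr (_ * _); rewrite mulrCA.
transitivity (\prod_i (y i ^ ((m1 * m2) * a r i)%N%:Z)).
  by apply: eq_bigr => i _; rewrite -yP -exprM.
under eq_bigr do rewrite key expfzDr //.
rewrite big_split /=; congr (_ * _).
  by apply: eq_bigr => i _; rewrite -yP -exprM.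
transitivity (\prod_i \prod_l y i ^ (w (l, i) * z (r, l))).
  apply: eq_bigr => i _; rewrite (big_morph (fun e : int => y i ^ e)
    (fun e f => expfzDr e f (nz_y i)) (expr0z _)).
  by apply: eq_bigr => l _; rewrite mulrC.
rewrite exchange_big; apply: eq_bigr => l _.
rewrite (big_morph (fun c : K => c ^ z (r, l))
  (fun c e => expfzMl c e _) (exp1rz _ _)).
by apply: eq_bigr => i _; rewrite exprz_exp.
Qed.

(** The indices [r] number the coefficients, [cls r] being the equation and [a r] the
    exponent to which the r-th one belongs.  One coefficient in each equation is a
    function of the other coefficients and of the monomial parameters, which leaves
    fewer free parameters than there are coefficients. *)
Lemma overdetermined_resultant (K : closedFieldType) (n q N : nat) (T : finType)
    (cls : 'I_N -> T) (J : {set T}) (B : {set 'I_N}) (a : 'I_N -> 'X_{1..n})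
    (D : 'M[rat]_(q, n)) :
  (forall j, j \in J -> exists2 r, r \in B & cls r = j) ->
  (forall r s, r \in B -> s \in B -> cls r = cls s -> cls r \in J ->
     (rat_exponent (a r) - rat_exponent (a s) <= D)%MS) ->
  (\rank D < #|J|)%N ->
  exists2 p : {mpoly K[N]}, p != 0 &
    forall (c : 'I_N -> K) (x : 'I_n -> K), (forall i, x i != 0) ->
      (forall j, j \in J -> \sum_(r in B | cls r == j) c r * mon x (a r) = 0) ->
      p.@[c] = 0.
Proof.
move=> exB subD ltDJ.
have [j0 /exB[r0 _ _]] : exists j, j \in J.
  by apply/card_gt0P; apply: leq_ltn_trans ltDJ.
have /choice[b bP] j : exists r, j \in J -> r \in B /\ cls r = j.
  by case: (boolP (j \in J)) => [/exB[r]|_]; [exists r | exists r0].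
pose B' := [set r in B | cls r \in J]%SET.
have [|z zP] := @monomial_parametrization K n q 'I_N B' a (fun r => a (b (cls r))) D.
  move=> r /[!inE] /andP[rB rJ]; have [bB bJ] := bP _ rJ.
  exact: subD.
set d : nat := \rank D in z zP ltDJ.
pose base := b @: J.
have card_base : #|base| = #|J|.
  by apply: card_in_imset => i j /bP[_ {2}<-] /bP[_ {2}<-] ->.
(* The unknowns are the coefficients outside [base] and the parameters. *)
pose V := ({r : 'I_N | r \notin base} + 'I_d)%type.
have ltVN : (#|{: V}| < N)%N.
  have leJN : (#|J| <= N)%N by rewrite -card_base (leq_trans (max_card _)) ?card_ord.
  have cN : #|[pred r | r \notin base]| = (N - #|J|)%N.
    apply: (@addnI #|J|); rewrite subnKC // -card_base.
    by have := cardC (mem base); rewrite card_ord.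
  rewrite card_sum card_sig card_ord cN.
  by rewrite -[X in (_ < X)%N](subnK leJN) ltn_add2l.
(* The exponents [z r l] may be negative.  Writing a free coefficient as an
   unknown times the E-th powers of all parameters shifts them to
   non-negative ones. *)
pose E := (\max_r \max_l `|z r l|)%N.
have leE r l : (`|z r l| <= E)%N.
  exact: leq_trans (leq_bigmax_cond (F := fun l => `|z r l|%N) _ _)
    (leq_bigmax_cond (F := fun r => (\max_l `|z r l|)%N) _ _).
pose vX r : {mpoly K[#|{: V}|]} :=
  if insub r is Some k then 'X_(enum_rank (inl k : V)) else 0.
pose vS l : {mpoly K[#|{: V}|]} := 'X_(enum_rank (inr l : V)).
pose F r := if r \in base then
    - \sum_(k in B | (cls k == cls r) && (k != r)) vX k * \prod_l vS l ^+ `|E%:Z + z k l|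
  else vX r * \prod_l vS l ^+ E.
have [p nz_p pF] := algebraic_relation [tuple F r | r < N] ltVN.
exists p => // c x nz_x eqc.
have [s nz_s sP] := zP x nz_x.
pose S := \prod_l s l ^+ E.
have nz_S : S != 0 by apply/prodf_neq0 => l _; rewrite expf_neq0.
pose eta (v : V) := match v with inl k => c (val k) / S | inr l => s l end.
pose y (i : 'I_#|{: V}|) := eta (enum_val i).
have vXy k : k \notin base -> (vX k).@[y] = c k / S.
  by move=> kP; rewrite /vX insubT mevalXU /y enum_rankK.
have vSy l : (vS l).@[y] = s l by rewrite mevalXU /y enum_rankK.
have Fy r : (F r).@[y] = c r.
  rewrite /F; case: ifPn => [/imsetP[j jJ ->{r}]|rP]; last first.
    rewrite mevalM vXy // rmorph_prod /=; under eq_bigr do rewrite rmorphXn /= vSy.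
    by rewrite divfK.
  have [bB bj] := bP _ jJ; rewrite bj.
  have := eqc j jJ; rewrite (bigD1 (b j)) ?bB ?bj ?eqxx //= => /eqP.
  rewrite addr_eq0 => /eqP eqb; apply: (mulIf (mon_neq0 (a (b j)) nz_x)).
  rewrite eqb mevalN mulNr raddf_sum mulr_suml /=; congr (- _).
  apply: eq_big => [k|k /and3P[kB /eqP kj ne_kb]]; first by rewrite andbA.
  have kN : k \notin base.
    by apply: contra ne_kb => /imsetP[i /bP[_ bi] kb]; rewrite kb -kj kb bi.
  have prodE : (\prod_l vS l ^+ `|E%:Z + z k l|).@[y] = S * \prod_l s l ^ z k l.
    rewrite rmorph_prod -big_split /=; apply: eq_bigr => l _.
    rewrite rmorphXn /= vSy !exprnP -expfzDr //; congr (_ ^ _); apply: gez0_abs.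
    by rewrite addrC -[E%:Z]opprK subr_ge0 lerNl (le_trans (ler_norm _)) //
      normrN -abszE lez_nat.
  rewrite mevalM vXy // prodE (sP k); last by rewrite inE kB kj.
  by rewrite kj (mulrA (c k / S)) (divfK nz_S) -mulrA; congr (_ * _); rewrite mulrC.
have := comp_mpoly_meval y p [tuple F r | r < N]; rewrite pF meval0 => ->.
by apply: meval_eq => r; rewrite tnth_mktuple Fy.
Qed.

(** * Tuples avoiding all resultants *)

(** The matrix [D] only serves to bound the dimension of the span of all differences
    of selected exponents: any matrix whose rows span them may be used. *)
Definition totally_nondegenerate (K : closedFieldType) (n m : nat)
    (f : 'I_m -> {mpoly K[n]}) : Prop :=
  forall (J : {set 'I_m}) (B : 'I_m -> pred 'X_{1..n}) (q : nat) (D : 'M[rat]_(q, n)),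
    (forall j, j \in J -> exists2 a, a \in msupp (f j) & B j a) ->
    (forall j a b, j \in J -> a \in msupp (f j) -> b \in msupp (f j) ->
       B j a -> B j b -> (rat_exponent a - rat_exponent b <= D)%MS) ->
    (\rank D < #|J|)%N ->
    ~ exists2 x : 'I_n -> K, (forall i, x i != 0) &
        forall j, j \in J -> \sum_(a <- msupp (f j) | B j a) (f j)@_a * mon x a = 0.

Lemma exists_coefs (K : closedFieldType) (n m : nat)
    (A : 'I_m -> {fset 'X_{1..n}}) (c : 'I_#|coef_index A| -> K) :
  exists2 f, supported_in A f & coefs A f = c.
Proof.
exists (fun j =>
  \sum_(a : A j) c (enum_rank (Tagged (fun j => A j : Type) a)) *: 'X_[val a]).
  move=> j b; rewrite mcoeff_msupp raddf_sum /=; apply: contraNT => bA.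
  rewrite big1 // => a _; rewrite mcoeffZ mcoeffX.
  by case: eqP => [eq_ab|_]; [rewrite -eq_ab fsvalP in bA | rewrite mulr0].
apply/funext => i; rewrite /coefs; set t := enum_val i.
rewrite raddf_sum (bigD1 (tagged t)) //= mcoeffZ mcoeffX eqxx mulr1 big1 ?addr0.
  by rewrite /t; case: (enum_val i) (enum_valK i) => j a /= <-.
move=> a ne_a; rewrite mcoeffZ mcoeffX.
by rewrite (inj_eq val_inj) (negPf ne_a) mulr0.
Qed.

Lemma sum_coefs (K : closedFieldType) (n m : nat) (A : 'I_m -> {fset 'X_{1..n}})
    (f : 'I_m -> {mpoly K[n]}) (B : 'I_m -> pred 'X_{1..n}) (j : 'I_m)
    (F : 'X_{1..n} -> K) :
  (forall j, msupp (f j) =i A j) ->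
  \sum_(a <- msupp (f j) | B j a) (f j)@_a * F a =
  \sum_(r : 'I_#|coef_index A| | B (tag (enum_val r)) (val (tagged (enum_val r)))
                                 && (tag (enum_val r) == j))
     coefs A f r * F (val (tagged (enum_val r))).
Proof.
move=> suppE; have pfA : perm_eq (msupp (f j)) (A j).
  by apply: uniq_perm; rewrite ?msupp_uniq ?fset_uniq.
rewrite (perm_big _ pfA) /= big_seq_fsetE /=.
transitivity (\sum_(t : coef_index A | (tag t == j) && B (tag t) (val (tagged t)))
    (f (tag t))@_(val (tagged t)) * F (val (tagged t))).
  rewrite -(sig_big_dep (J := fun j => A j : finType) (fun i => i == j)
    (fun i a => B i (val a)) (fun i a => (f i)@_(val a) * F (val a))).
  by rewrite big_pred1_eq.
rewrite (reindex_onto enum_val enum_rank) /=; last by move=> t _; rewrite enum_rankK.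
by apply: eq_bigl => r; rewrite enum_valK eqxx andbT andbC.
Qed.

(** The selections [B j] only matter on the finite sets [A j], so finitely many
    resultants have to be avoided.  The coordinates are added as factors in order
    to make all supports full. *)
Lemma exists_nondegenerate_open (K : closedFieldType) (n m : nat)
    (A : 'I_m -> {fset 'X_{1..n}}) :
  exists U : set ('I_m -> {mpoly K[n]}),
    [/\ zariski_open A U, U !=set0,
        forall f, U f -> forall j, msupp (f j) =i A j
      & forall f, U f -> totally_nondegenerate f].
Proof.
pose N := #|coef_index A|.
pose cls (r : 'I_N) := tag (enum_val r).
pose ex (r : 'I_N) : 'X_{1..n} := val (tagged (enum_val r)).
have /choice[p pP] : forall JB : {set 'I_m} * {set 'I_N},
    exists p : {mpoly K[N]}, p != 0 /\ forall (q : nat) (D : 'M[rat]_(q, n)),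
      (forall j, j \in JB.1 -> exists2 r, r \in JB.2 & cls r = j) ->
      (forall r s, r \in JB.2 -> s \in JB.2 -> cls r = cls s -> cls r \in JB.1 ->
        (rat_exponent (ex r) - rat_exponent (ex s) <= D)%MS) ->
      (\rank D < #|JB.1|)%N ->
      forall (c : 'I_N -> K) (x : 'I_n -> K), (forall i, x i != 0) ->
      (forall j, j \in JB.1 -> \sum_(r in JB.2 | cls r == j) c r * mon x (ex r) = 0) ->
      p.@[c] = 0.
  move=> [J Bs] /=.
  case: (pselect (exists (q : nat) (D : 'M[rat]_(q, n)), [/\
     (forall j, j \in J -> exists2 r, r \in Bs & cls r = j),
     (forall r s, r \in Bs -> s \in Bs -> cls r = cls s -> cls r \in J ->
       (rat_exponent (ex r) - rat_exponent (ex s) <= D)%MS)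
   & (\rank D < #|J|)%N])) => [[q [D [h1 h2 h3]]]|no].
    have [p nz_p pP] := @overdetermined_resultant K _ _ _ _ cls J Bs ex D h1 h2 h3.
    by exists p; split=> // _ _ _ _ _.
  exists 1; split=> [|q D h1 h2 h3]; first exact: oner_neq0.
  by case: no; exists q, D.
pose P := (\prod_JB p JB) * \prod_i 'X_i.
have nz_P : P != 0.
  apply: mulf_neq0; apply/prodf_neq0 => i _; first by case: (pP i).
  by rewrite -msupp_eq0 msuppX.
exists [set f | supported_in A f /\ exists2 p, [set P] p & p.@[coefs A f] != 0].
have PE (f : 'I_m -> {mpoly K[n]}) : P.@[coefs A f] != 0 ->
    (forall JB, (p JB).@[coefs A f] != 0) /\ (forall i, coefs A f i != 0).
  rewrite mevalM mulf_eq0 !rmorph_prod negb_or => /andP[/prodf_neq0 h /prodf_neq0 h'].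
  by split=> i; [apply: h | have := h' i isT; rewrite /= mevalXU].
have suppE (f : 'I_m -> {mpoly K[n]}) : supported_in A f -> P.@[coefs A f] != 0 ->
    forall j, msupp (f j) =i A j.
  move=> Af /PE[_ nz] j b; apply/idP/idP => [/Af //|bA].
  have := nz (enum_rank (Tagged (fun j => A j : Type) [` bA]%fset)).
  by rewrite /coefs enum_rankK /= -mcoeff_msupp.
split; first by exists [set P].
- have [c nz_Pc] := mpoly_nonroot nz_P; have [f Af fc] := exists_coefs c.
  by exists f; split=> //; exists P => //; rewrite fc.
- by move=> f [Af [_ -> nz]]; apply: suppE.
move=> f [Af [_ -> nz]] J B q D exB subD ltDJ [x nz_x eqx].
have suppf := suppE f Af nz.
pose Bs := [set r : 'I_N | B (cls r) (ex r)]%SET.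
have exf r : ex r \in msupp (f (cls r)) by rewrite suppf; apply: fsvalP.
have [+ _] := PE f nz; move=> /(_ (J, Bs))/negP; apply; apply/eqP.
have [_] := pP (J, Bs); apply=> /= [j jJ|r s|||j jJ].
- have [a fa Ba] := exB j jJ; rewrite suppf in fa.
  exists (enum_rank (Tagged (fun j => A j : Type) [` fa]%fset)).
    by rewrite inE /cls /ex enum_rankK.
  by rewrite /cls enum_rankK.
- rewrite !inE => Br Bs' rs rJ.
  by apply: (subD (cls r)) => //; rewrite rs.
- exact: ltDJ.
- exact: nz_x.
apply: etrans (eqx j jJ); rewrite (sum_coefs B j (mon x) suppf).
by apply: eq_bigl => r; rewrite inE.
Qed.

(** * Restrictions and initial forms *)

Definition mnm_in (n : nat) (I : {set 'I_n}) (a : 'X_{1..n}) : bool :=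
  [forall i, (i \notin I) ==> (a i == 0%N)].

Lemma mnm_inP (n : nat) (I : {set 'I_n}) (a : 'X_{1..n}) :
  reflect (forall i, i \notin I -> a i = 0%N) (mnm_in I a).
Proof.
by apply: (iffP forallP) => h i; [move/(implyP (h i))/eqP | apply/implyP => /h ->].
Qed.

Lemma mcoeff_restr (K : closedFieldType) (n : nat) (I : {set 'I_n})
    (f : {mpoly K[n]}) (a : 'X_{1..n}) :
  (restr I f)@_a = if mnm_in I a then f@_a else 0.
Proof.
have monE (m : 'X_{1..n}) :
    \prod_(i < n) tnth [tuple if i \in I then 'X_i else 0 : {mpoly K[n]} | i < n] i ^+ m i
    = if mnm_in I m then 'X_[m] else 0.
  case: mnm_inP => [mI|nmI].
    rewrite mpolyXE_id; apply: eq_bigr => i _; rewrite tnth_mktuple.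
    by case: ifPn => // /mI ->; rewrite !expr0.
  have [i /andP[iI mi]] : exists i, (i \notin I) && (m i != 0%N).
    apply/existsP; apply: contra_notT nmI => /existsPn h i iI.
    by have := h i; rewrite iI negbK => /eqP.
  apply/eqP/prodf_eq0; exists i => //.
  by rewrite tnth_mktuple (negPf iI) expr0n (negPf mi).
rewrite /restr comp_mpolyE raddf_sum /=.
under eq_bigr do rewrite mcoeffZ monE (fun_if (mcoeff a)) mcoeffX mcoeff0.
case: (boolP (a \in msupp f)) => [fa|nfa].
  rewrite (bigD1_seq a) ?msupp_uniq //= eqxx big1 ?addr0.
    by case: ifP => _; rewrite ?mulr1 ?mulr0.
  by move=> b /negPf ne_ba; rewrite ne_ba if_same mulr0.
rewrite (memN_msupp_eq0 nfa) if_same big_seq big1 // => b fb.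
by case: eqP => [eq_ba|]; rewrite ?if_same ?mulr0 //; rewrite eq_ba (negPf nfa) in fb.
Qed.

Lemma msupp_restr (K : closedFieldType) (n : nat) (I : {set 'I_n})
    (f : {mpoly K[n]}) (a : 'X_{1..n}) :
  (a \in msupp (restr I f)) = mnm_in I a && (a \in msupp f).
Proof. by rewrite !mcoeff_msupp mcoeff_restr; case: ifP; rewrite ?eqxx. Qed.

Lemma restr_neq0 (K : closedFieldType) (n : nat) (I : {set 'I_n})
    (f : {mpoly K[n]}) :
  (restr I f != 0) <-> exists2 a, a \in msupp f & mnm_in I a.
Proof.
rewrite -msupp_eq0; split=> [|[a fa aI]]; last first.
  apply/eqP => s0; have : a \in msupp (restr I f) by rewrite msupp_restr aI.
  by rewrite s0.
case E: (msupp _) => [|a s] // _; have : a \in msupp (restr I f) by rewrite E mem_head.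
by rewrite msupp_restr => /andP[aI fa]; exists a.
Qed.

Definition minimal_exponent (K : closedFieldType) (n : nat) (v : 'rV[int]_n)
    (g : {mpoly K[n]}) (a : 'X_{1..n}) : bool :=
  all (fun b => weight v a <= weight v b) (msupp g).

Lemma exists_minimal (T : eqType) (w : T -> int) (s : seq T) :
  s != [::] -> exists2 a, a \in s & all (fun b => w a <= w b) s.
Proof.
elim: s => // c [|d s] IHs _; first by exists c; rewrite ?mem_head //= lexx.
have [//|a sa /allP mina] := IHs.
have [le_ca|lt_ac] := leP (w c) (w a).
  exists c; first exact: mem_head.
  apply/allP => b.
  rewrite inE => /predU1P[->|/mina]; first exact: lexx.
  exact: le_trans.
exists a; first by rewrite inE sa orbT.
by apply/allP => b; rewrite inE => /predU1P[->|/mina //]; apply: ltW.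
Qed.

Lemma exists_minimal_exponent (K : closedFieldType) (n : nat) (v : 'rV[int]_n)
    (g : {mpoly K[n]}) :
  g != 0 -> exists2 a, a \in msupp g & minimal_exponent v g a.
Proof. by rewrite -msupp_eq0; apply: exists_minimal. Qed.

Lemma meval_initial_form (K : closedFieldType) (n : nat) (v : 'rV[int]_n)
    (g : {mpoly K[n]}) (x : 'I_n -> K) :
  (initial_form v g).@[x] =
  \sum_(a <- msupp g | minimal_exponent v g a) g@_a * mon x a.
Proof.
rewrite /initial_form raddf_sum; apply: eq_bigr => a _.
by rewrite /= mevalZ mevalX.
Qed.

Lemma sum_restr (K : closedFieldType) (n : nat) (I : {set 'I_n})
    (f : {mpoly K[n]}) (P : pred 'X_{1..n}) (F : 'X_{1..n} -> K) :
  \sum_(a <- msupp (restr I f) | P a) (restr I f)@_a * F a =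
  \sum_(a <- msupp f | mnm_in I a && P a) f@_a * F a.
Proof.
have pE : perm_eq (msupp (restr I f)) [seq a <- msupp f | mnm_in I a].
  apply: uniq_perm; rewrite ?filter_uniq ?msupp_uniq // => a.
  by rewrite msupp_restr mem_filter.
rewrite (perm_big _ pE) /= big_filter_cond.
by apply: eq_bigr => a /andP[aI _]; rewrite mcoeff_restr aI.
Qed.

Lemma initial_forms_no_zero (K : closedFieldType) (n m : nat)
    (f : 'I_m -> {mpoly K[n]}) (I : {set 'I_n}) (v : 'rV[int]_n)
    (J : {set 'I_m}) (q : nat) (D : 'M[rat]_(q, n)) (x : 'I_n -> K) :
  totally_nondegenerate f ->
  (forall j, j \in J -> restr I (f j) != 0) ->
  (forall j a b, j \in J ->
     a \in msupp (restr I (f j)) -> minimal_exponent v (restr I (f j)) a ->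
     b \in msupp (restr I (f j)) -> minimal_exponent v (restr I (f j)) b ->
     (rat_exponent a - rat_exponent b <= D)%MS) ->
  (\rank D < #|J|)%N -> (forall i, x i != 0) ->
  ~ forall j, j \in J -> (initial_form v (restr I (f j))).@[x] = 0.
Proof.
move=> ndg nzJ subD ltDJ nz_x fx0.
apply: (ndg J (fun j a => mnm_in I a && minimal_exponent v (restr I (f j)) a) q D) => //.
- move=> j /nzJ /(exists_minimal_exponent v)[a].
  by rewrite msupp_restr => /andP[aI fa] mina; exists a => //; rewrite aI.
- move=> j a b jJ fa fb /andP[aI mina] /andP[bI minb].
  by apply: (subD j); rewrite // msupp_restr ?aI ?bI.
by exists x => // j /fx0; rewrite meval_initial_form sum_restr.
Qed.

(** The differences of exponents of minimal weight are supported in [I] and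
    orthogonal to [v], which leaves a space of dimension |I| - 1. *)
Lemma nonzero_weight_no_zero (K : closedFieldType) (n m : nat)
    (f : 'I_m -> {mpoly K[n]}) (I : {set 'I_n}) (v : 'rV[int]_n) (x : 'I_n -> K) :
  totally_nondegenerate f -> weight_on I v -> v != 0 ->
  (#|I| <= #|[set j | restr I (f j) != 0%R]%SET|)%N ->
  (forall i, x i != 0) ->
  ~ forall j, (initial_form v (restr I (f j))).@[x] = 0.
Proof.
move=> ndg vI nz_v leIJ nz_x fx0.
have [i0 nz_v0] := rV0Pn _ nz_v.
have i0I : i0 \in I by apply: contra_neqT nz_v0 => /vI.
pose w i : rat := (v 0 i)%:~R.
have nz_w0 : w i0 != 0 by rewrite intr_eq0.
(* The [u i] with i in [I] other than [i0] span the vectors that are supported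
   in [I] and orthogonal to [v]. *)
pose u i : 'rV[rat]_n := delta_mx 0 i - (w i / w i0) *: delta_mx 0 i0.
pose D := \matrix_(k < #|I :\ i0|) u (enum_val k).
apply: (@initial_forms_no_zero _ _ _ f I v [set j | restr I (f j) != 0%R]%SET
  _ D x) => //.
- by move=> j; rewrite inE.
- move=> j a b _; rewrite !msupp_restr => /andP[/mnm_inP aI fa] /allP mina.
  move=> /andP[/mnm_inP bI fb] /allP minb.
  have wab : weight v a = weight v b.
    by apply/le_anti/andP; split; [apply: mina | apply: minb];
       rewrite msupp_restr ?fa ?fb andbT; apply/mnm_inP.
  pose e i : rat := (a i)%:R - (b i)%:R.
  have we : \sum_i w i * e i = 0.
    have := congr1 (fun z : int => z%:~R : rat) wab; rewrite /weight !rmorph_sum /=.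
    move/eqP; rewrite -subr_eq0 -sumrB => /eqP; apply: etrans; apply: eq_bigr => i _.
    by rewrite mulrBr !rmorphM.
  have eE : rat_exponent a - rat_exponent b = \sum_(i in I :\ i0) e i *: u i.
    apply/rowP => k; rewrite !mxE summxE.
    under eq_bigr do rewrite !mxE eqxx /= mulrBr.
    rewrite sumrB; have [->|ne_k] := eqVneq k i0.
      rewrite big1 ?sub0r => [|i /setD1P[ne_i _]]; last first.
        by rewrite eq_sym (negPf ne_i) mulr0.
      apply: (mulIf nz_w0); rewrite mulNr mulr_suml.
      move/eqP: we; rewrite (bigID (mem I)) /= [X in _ + X]big1 ?addr0; last first.
        by move=> i /vI vi; rewrite /w vi mul0r.
      rewrite (bigD1 i0) //= addr_eq0 mulrC => /eqP ->; congr (- _).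
      apply: eq_big => [i|i _]; first by rewrite in_setD1 andbC.
      by rewrite mulr1 -mulrA divfK // mulrC.
    rewrite [X in _ = _ - X]big1 ?subr0 => [|i _]; last by rewrite !mulr0.
    have [kI|kI] := boolP (k \in I); last first.
      rewrite aI // bI // subrr big1 // => i /setD1P[_ iI].
      by case: eqP => [eq_ki|]; rewrite ?mulr0 //; rewrite eq_ki iI in kI.
    rewrite (bigD1 k) /=; last by rewrite in_setD1 ne_k.
    rewrite eqxx mulr1 big1 ?addr0 // => i /andP[_ ne_ik].
    by rewrite eq_sym (negPf ne_ik) mulr0.
  rewrite eE; apply: summx_sub => i iP; apply: scalemx_sub.
  have -> : u i = row (enum_rank_in iP i) D by rewrite rowK enum_rankK_in.
  exact: row_sub.
- by apply: leq_ltn_trans (rank_leq_row D) _; apply: leq_trans leIJ;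
  rewrite [X in (_ < X)%N](cardsD1 i0) i0I.
Qed.

(** * Faces of Minkowski sums and complete BKK non-degeneracy *)

Lemma dot_sumr (R : realType) (n : nat) (u : 'rV[R]_n) (T : finType) (P : pred T)
    (F : T -> 'rV[R]_n) :
  dot u (\sum_(t | P t) F t) = \sum_(t | P t) dot u (F t).
Proof.
rewrite exchange_big; apply: eq_bigr => i _.
by rewrite summxE mulr_sumr.
Qed.

Lemma dotZr (R : realType) (n : nat) (u x : 'rV[R]_n) (c : R) :
  dot u (c *: x) = c * dot u x.
Proof. by rewrite mulr_sumr; apply: eq_bigr => i _; rewrite mxE mulrCA. Qed.

Lemma dot_exponent (R : realType) (n : nat) (v : 'rV[int]_n) (a : 'X_{1..n}) :
  dot (map_mx intr v) (exponent R a) = (weight v a)%:~R.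
Proof. by rewrite rmorph_sum; apply: eq_bigr => i _; rewrite !mxE rmorphM. Qed.

Lemma sub_convex_hull (R : realType) (n : nat) (S : set 'rV[R]_n) (x : 'rV[R]_n) :
  S x -> convex_hull S x.
Proof.
move=> Sx; exists 1%N, (fun=> x), (fun=> 1).
by split; rewrite ?big_ord1 ?scale1r // => _; apply: ler01.
Qed.

Lemma convex_hull_dot_ge (R : realType) (n : nat) (S : set 'rV[R]_n)
    (u : 'rV[R]_n) (t : R) :
  (forall s, S s -> t <= dot u s) -> forall x, convex_hull S x -> t <= dot u x.
Proof.
move=> leS x [k [p [l [Sp l_ge0 l1 ->]]]].
rewrite dot_sumr -[t]mul1r -l1 mulr_suml; apply: ler_sum => i _.
by rewrite dotZr ler_wpM2l // leS.
Qed.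

Lemma exponent_newton_polytope (R : realType) (K : closedFieldType) (n : nat)
    (g : {mpoly K[n]}) (a : 'X_{1..n}) :
  a \in msupp g -> newton_polytope R g (exponent R a).
Proof. by move=> ga; apply: sub_convex_hull; exists a. Qed.

Lemma face_minkowski_sum (R : realType) (K : closedFieldType) (n : nat) (T : finType)
    (J : {set T}) (g : T -> {mpoly K[n]}) (v : 'rV[int]_n) (c : T -> 'X_{1..n}) :
  (forall j, j \in J -> c j \in msupp (g j)) ->
  (forall j, j \in J -> minimal_exponent v (g j) (c j)) ->
  face (map_mx intr v) (minkowski_sum J (fun j => newton_polytope R (g j)))
    (\sum_(j in J) exponent R (c j)).
Proof.
move=> gc minc; split.
  by exists (fun j => exponent R (c j)) => // j /gc; apply: exponent_newton_polytope.
move=> _ [y Qy ->]; rewrite !dot_sumr; apply: ler_sum => j jJ.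
rewrite dot_exponent; apply: convex_hull_dot_ge (Qy j jJ) => _ [b gb <-].
by rewrite dot_exponent ler_int (allP (minc j jJ)).
Qed.

Lemma leq_affdim (R : realType) (n d : nat) (S : set 'rV[R]_n) (x0 : 'rV[R]_n)
    (M : 'M[R]_(d, n)) :
  S x0 -> (forall i, S (x0 + row i M)) -> row_free M -> (d <= affdim S)%N.
Proof.
move=> Sx SM freeM.
have le_dn : (d < n.+1)%N by rewrite ltnS -(eqP freeM) rank_leq_col.
apply: (leq_bigmax_cond (F := @nat_of_ord n.+1) (Ordinal le_dn)) => /=.
by apply/asboolP; exists x0, M.
Qed.

(** If one summand of a point of the face is replaced by another exponent of minimal
    weight, the result is again a point of the face.  Hence, if [c j] is a fixed
    exponent of minimal weight, the face contains the translates by [a - c j] of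
    one of its points, and these differences span all the others.  They are
    integral, so their rank is the same over the rationals and over the reals. *)
Lemma initial_directions (R : realType) (K : closedFieldType) (n : nat) (T : finType)
    (J : {set T}) (g : T -> {mpoly K[n]}) (v : 'rV[int]_n) :
  (forall j, j \in J -> g j != 0) ->
  exists (q : nat) (D : 'M[rat]_(q, n)),
    (\rank D <= affdim (face (map_mx intr v)
       (minkowski_sum J (fun j => newton_polytope R (g j)))))%N /\
    forall j a b, j \in J ->
     a \in msupp (g j) -> minimal_exponent v (g j) a ->
     b \in msupp (g j) -> minimal_exponent v (g j) b ->
     (rat_exponent a - rat_exponent b <= D)%MS.
Proof.
move=> nz_g.
have /choice[c cP] j : exists a, j \in J -> a \in msupp (g j) /\ minimal_exponent v (g j) a.
  have [/nz_g/(exists_minimal_exponent v)[a ga mina]|_] := boolP (j \in J).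
    by exists a.
  by exists 0%MM.
pose L := flatten [seq [seq (j, a) | a <- msupp (g j) & minimal_exponent v (g j) a]
                  | j <- enum J].
have LP j a : ((j, a) \in L) = [&& j \in J, a \in msupp (g j) & minimal_exponent v (g j) a].
  apply/flatten_mapP/and3P => [[k]|[jJ ga mina]].
    by rewrite mem_enum => kJ /mapP[b]; rewrite mem_filter => /andP[minb gb] [-> ->].
  exists j; first by rewrite mem_enum.
  by apply/mapP; exists a; rewrite // mem_filter mina.
pose D := \matrix_(k < size L)
  (rat_exponent (tnth (in_tuple L) k).2 - rat_exponent (c (tnth (in_tuple L) k).1)).
have subD j a : (j, a) \in L -> (rat_exponent a - rat_exponent (c j) <= D)%MS.
  move=> /(tnthP (in_tuple L))[k ja].
  have -> : rat_exponent a - rat_exponent (c j) = row k D by rewrite rowK -ja.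
  exact: row_sub.
exists (size L), D; split; last first.
  move=> j a b jJ ga mina gb minb.
  have -> : rat_exponent a - rat_exponent b =
      (rat_exponent a - rat_exponent (c j)) - (rat_exponent b - rat_exponent (c j)).
    by rewrite opprB addrA subrK.
  by rewrite addmx_sub ?eqmx_opp ?subD // LP jJ ?ga ?gb.
pose M := map_mx (@ratr R) (rowsub (maxrankfun D) D).
apply: (@leq_affdim _ _ _ _ (\sum_(j in J) exponent R (c j)) M).
- by apply: face_minkowski_sum => j /cP[].
- move=> i; pose ja := tnth (in_tuple L) (maxrankfun D i).
  have /and3P[jJ ga mina] :
      [&& ja.1 \in J, ja.2 \in msupp (g ja.1) & minimal_exponent v (g ja.1) ja.2].
    by rewrite -LP -surjective_pairing mem_tnth.
  (* Exchanging the summand of index [ja.1] moves the base point by row i. *)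
  pose c' j := if j == ja.1 then ja.2 else c j.
  have -> : \sum_(j in J) exponent R (c j) + row i M = \sum_(j in J) exponent R (c' j).
    rewrite (bigD1 ja.1) //= [RHS](bigD1 ja.1) //= addrAC; congr (_ + _).
      rewrite /c' eqxx; apply/rowP => k; rewrite !mxE -/ja rmorphB /= !ratr_nat.
      by rewrite addrC subrK.
    by apply: eq_bigr => j /andP[_ /negPf ne_j]; rewrite /c' ne_j.
  by apply: face_minkowski_sum => j jJ'; rewrite /c';
    case: eqP => [->|_] //; case: (cP j jJ').
by rewrite row_free_map maxrowsub_free.
Qed.

Lemma totally_nondegenerate_BKK (R : realType) (K : closedFieldType) (n m : nat)
    (f : 'I_m -> {mpoly K[n]}) :
  totally_nondegenerate f -> completely_BKK_on_affine R f.
Proof.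
move=> ndg I _ J v _ _ ltJ [x nz_x fx0].
have [//|q [D [leD subD]]] := @initial_directions R K n _ J
   (fun j : {j : 'I_m | restr I (f j) != 0} => restr I (f (val j))) v.
  by move=> j _; apply: (valP j).
have memJ j : j \in val @: J -> exists2 k, k \in J & j = val k by move/imsetP.
apply: (@initial_forms_no_zero K n m f I v (val @: J) q D x) => //.
- by move=> j /memJ[k _ ->]; apply: (valP k).
- by move=> j a b /memJ[k kJ ->]; apply: subD.
- by rewrite card_imset; [apply: leq_ltn_trans ltJ | apply: val_inj].
- by move=> i; rewrite nz_x inE.
by move=> j /memJ[k kJ ->]; apply: fx0.
Qed.

(** * Non-degeneracy with respect to polytopes *)

Definition hull_of (R : realType) (n : nat) (A : {fset 'X_{1..n}}) : set 'rV[R]_n :=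
  convex_hull (exponent R @` [set a | a \in A]).
Arguments hull_of R {n} A.

(** The coordinates outside [I] are non-negative on all exponents, so a point on which
    they vanish is a combination of exponents on which they vanish. *)
Lemma convex_hull_coord_space (R : realType) (n : nat) (A : {fset 'X_{1..n}})
    (I : {set 'I_n}) (x : 'rV[R]_n) :
  hull_of R A x -> coord_space R I x -> exists2 a, a \in A & mnm_in I a.
Proof.
move=> [k [p [l [Ap l_ge0 l1 ->]]]] xI.
have [i nz_l] : exists i, l i != 0.
  apply/existsP; apply: contra_neqT (oner_neq0 R) => /existsPn l0.
  by rewrite -l1 big1 // => i _; apply/eqP; have := l0 i; rewrite negbK.
have [a Aa pa] := Ap i; exists a => //; apply/mnm_inP => t tI.
have p_ge0 j : 0 <= l j * p j 0 t.
  by have [b _ <-] := Ap j; rewrite mxE mulr_ge0 ?ler0n.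
have := xI t tI; rewrite summxE => /eqP.
under eq_bigr do rewrite mxE.
rewrite psumr_eq0 => [/allP/(_ i (mem_index_enum _))/=|j _]; last exact: p_ge0.
by rewrite mulf_eq0 (negPf nz_l) -pa mxE pnatr_eq0 => /eqP.
Qed.

Lemma newton_polytope_hull (R : realType) (K : closedFieldType) (n : nat)
    (f : {mpoly K[n]}) (A : {fset 'X_{1..n}}) :
  msupp f =i A -> newton_polytope R f = hull_of R A.
Proof.
move=> fA; rewrite /newton_polytope /hull_of; congr (convex_hull (_ @` _)).
by apply/seteqP; split=> a /=; rewrite fA.
Qed.

Lemma weightN (n : nat) (w : 'rV[int]_n) (a : 'X_{1..n}) : weight (- w) a = - weight w a.
Proof. by rewrite -sumrN; apply: eq_bigr => i _; rewrite mxE mulNr. Qed.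

Lemma leading_formE (K : closedFieldType) (n : nat) (w : 'rV[int]_n) (g : {mpoly K[n]}) :
  leading_form w g = initial_form (- w) g.
Proof.
apply: eq_bigl => a; apply: eq_all => b.
by rewrite !weightN lerN2.
Qed.

Lemma nonexceptional_card (R : realType) (K : closedFieldType) (n : nat)
    (A : 'I_n -> {fset 'X_{1..n}}) (f : 'I_n -> {mpoly K[n]}) (I : {set 'I_n}) :
  (forall j, msupp (f j) =i A j) -> ~ exceptional (fun j => hull_of R (A j)) I ->
  (#|I| <= #|[set j | restr I (f j) != 0%R]%SET|)%N.
Proof.
move=> suppf nexc.
have leI : (#|I| <= #|nonempty_at (fun j => hull_of R (A j)) I|)%N.
  by rewrite leqNgt; apply/negP => ltI; apply: nexc; exists I.
apply: leq_trans leI _; apply/subset_leq_card/fintype.subsetP => j.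
rewrite /nonempty_at !inE => -[x [Ax xI]]; apply/restr_neq0.
by have [a Aa aI] := convex_hull_coord_space Ax xI; exists a; rewrite // suppf.
Qed.

(** All weights that occur are non-zero: those at infinity have a positive entry, and
    the others are positive on the complement of a subset of [I] that differs from
    [I], one of the two being exotrivial and the other not. *)
Lemma totally_nondegenerate_polytope (R : realType) (K : closedFieldType) (n : nat)
    (A : 'I_n -> {fset 'X_{1..n}}) (f : 'I_n -> {mpoly K[n]}) :
  (forall j, msupp (f j) =i A j) -> totally_nondegenerate f ->
  polytope_nondegenerate (fun j => hull_of R (A j)) f.
Proof.
move=> suppf ndg; pose P := fun j => hull_of R (A j).
have no_zero I (v : 'rV[int]_n) : ~ exceptional P I -> weight_on I v -> v != 0 ->
    ~ common_zero_on [set: 'I_n]%SET [set: 'I_n]%SET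
        (fun j => initial_form v (restr I (f j))).
  move=> nexc vI nz_v [x nz_x fx0].
  have leI := nonexceptional_card suppf nexc.
  have nz i : x i != 0 by rewrite nz_x inE.
  by apply: (nonzero_weight_no_zero ndg vI nz_v leI nz) => j; apply: fx0; rewrite inE.
have BKK_atP (C : set {set 'I_n}) I : ~ exceptional P I -> ~ C I ->
    BKK_at C I (fun j => restr I (f j)).
  move=> nexc nCI v [vI _] [S [CS SI _ vpos]]; apply: no_zero => //.
  have /fintype.subsetPn[i iI iS] : ~~ (I \subset S).
    by apply: contra_notN nCI => IS; have -> : I = S;
      [apply/eqP; rewrite finset.eqEsubset IS | ].
  by apply: contraTneq (vpos i iI iS) => ->; rewrite mxE ltxx.
split=> [j|I [nexc nexo]|I [nexc exo]].
- exact: newton_polytope_hull.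
- split; last by apply: BKK_atP => // -[].
  move=> w [wI _ [i iI wi]] [x nz_x fx0]; apply: (no_zero I (- w)) => //.
  + by move=> k /wI wk; rewrite mxE wk oppr0.
  + by rewrite oppr_eq0; apply: contraTneq wi => ->; rewrite mxE ltxx.
  by exists x => // j /fx0; rewrite leading_formE.
by apply: BKK_atP => // -[].
Qed.

(** * Ideals of finite codimension need many generators *)

Lemma ps_mul_mcoeff (K : closedFieldType) (n : nat) (P Q : power_series K n)
    (p q : {mpoly K[n]}) (a : 'X_{1..n}) :
  (forall b c, a = (b + c)%MM -> P b * Q c = p@_b * q@_c) ->
  ps_mul P Q a = (p * q)@_a.
Proof. by move=> PQ; rewrite mcoeffM; apply: eq_bigr => k /eqP; apply: PQ. Qed.

Lemma mcoeffM_congr (K : closedFieldType) (n : nat) (p q p' q' : {mpoly K[n]})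
    (a : 'X_{1..n}) :
  (forall b c, a = (b + c)%MM -> p@_b * q@_c = p'@_b * q'@_c) ->
  (p * q)@_a = (p' * q')@_a.
Proof. by move=> pq; rewrite !mcoeffM; apply: eq_bigr => k /eqP; apply: pq. Qed.

Lemma mcoeffM_eq0 (K : closedFieldType) (n : nat) (p q : {mpoly K[n]})
    (a : 'X_{1..n}) :
  (forall b c, a = (b + c)%MM -> p@_b * q@_c = 0) -> (p * q)@_a = 0.
Proof.
move=> pq; rewrite -[RHS](mcoeff0 _ a) -[in RHS](mul0r q).
by apply: mcoeffM_congr => b c /pq ->; rewrite mcoeff0 mul0r.
Qed.

Definition truncate (K : closedFieldType) (n E : nat) (P : power_series K n) :
    {mpoly K[n]} :=
  \sum_(m : 'X_{1..n < E}) P m *: 'X_[m].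

Lemma mcoeff_truncate (K : closedFieldType) (n E : nat) (P : power_series K n)
    (a : 'X_{1..n}) :
  (mdeg a < E)%N -> (truncate E P)@_a = P a.
Proof. exact: mcoeff_mpoly. Qed.

Lemma mcoeff_exp_order (K : closedFieldType) (n i : nat) (u : {mpoly K[n]})
    (a : 'X_{1..n}) :
  u@_0 = 0 -> (mdeg a < i)%N -> (u ^+ i)@_a = 0.
Proof.
move=> u0; elim: i a => // i IHi a lt_ai; rewrite exprS.
apply: mcoeffM_eq0 => b c eq_a.
have [->|nz_b] := eqVneq b 0%MM; first by rewrite u0 mul0r.
rewrite IHi ?mulr0 // -ltnS (leq_trans _ lt_ai) // eq_a mdegD.
by rewrite ltnS -[X in (X < _)%N]add0n ltn_add2r lt0n mdeg_eq0.
Qed.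

(** With [u = 1 - g_j / g_j(0)], the inverse of [g_j] is the geometric series in [u]
    divided by g_j(0); as [u] has no constant term, each coefficient of a multiple
    of this series is that of a partial sum. *)
Lemma unit_ps_ideal (K : closedFieldType) (n r : nat) (g : 'I_r -> {mpoly K[n]})
    (j : 'I_r) (p : power_series K n) :
  (g j)@_0 != 0 -> ps_ideal g p.
Proof.
move=> nz_c; set c := (g j)@_0 in nz_c.
pose u := 1 - c^-1 *: g j.
have u0 : u@_0 = 0 by rewrite mcoeffB mcoeff1 eqxx mcoeffZ mulVf ?subrr.
pose Q N := c^-1 *: \sum_(i < N) u ^+ i.
have Qg N : Q N * g j = 1 - u ^+ N.
  rewrite -opprB subrX1 -mulNr opprB /u subKr [RHS]mulrC.
  by rewrite -!(scalerAl, scalerAr).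
have QE M N a : (mdeg a < M)%N -> (M <= N)%N -> (Q M)@_a = (Q N)@_a.
  move=> lt_aM le_MN; rewrite !mcoeffZ; congr (_ * _).
  rewrite -!(big_mkord xpredT (fun i => u ^+ i)) [in RHS](big_cat_nat (n := M)) //=.
  rewrite mcoeffD [X in _ + X]raddf_sum /= [X in _ + X]big_nat
    [X in _ + X]big1 ?addr0 // => i /andP[le_Mi _].
  by rewrite mcoeff_exp_order // (leq_trans lt_aM).
pose H N := truncate N p * Q N.
have HE M N a : (mdeg a < M)%N -> (M <= N)%N -> (H M)@_a = (H N)@_a.
  move=> lt_aM le_MN; apply: mcoeffM_congr => b d eq_a.
  have [leb led] : (mdeg b < M)%N /\ (mdeg d < M)%N.
    by move: lt_aM; rewrite eq_a mdegD => lt; split;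
       apply: leq_ltn_trans lt; rewrite ?leq_addr ?leq_addl.
  by rewrite (QE M N) // !mcoeff_truncate // (leq_trans leb).
exists (fun i => if i == j then fun a => (H (mdeg a).+1)@_a else fun=> 0) => a.
rewrite (bigD1 j) //= eqxx big1 ?addr0 => [|i /negPf ne_i]; last first.
  by rewrite ne_i; apply: big1 => k _; rewrite mul0r.
rewrite (@ps_mul_mcoeff _ _ _ _ (H (mdeg a).+1) (g j)) => [|b d eq_a]; last first.
  by rewrite (HE _ (mdeg a).+1) // ltnS eq_a mdegD leq_addr.
rewrite -mulrA Qg mulrBr mulr1 mcoeffB mcoeff_truncate // mcoeffM_eq0 ?subr0 //.
move=> b d eq_a; rewrite mcoeff_exp_order ?mulr0 // ltnS eq_a mdegD leq_addl //.
Qed.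

Lemma ps_quotient_dim_mcoeff0 (K : closedFieldType) (n r d : nat)
    (g : 'I_r -> {mpoly K[n]}) (j : 'I_r) :
  ps_quotient_dim g d -> (0 < d)%N -> (g j)@_0 = 0.
Proof.
move=> [b [indep _]] d_gt0; apply/eqP/negPn/negP => nz_c.
have /(_ (Ordinal d_gt0))/eqP := indep (fun=> 1) (unit_ps_ideal _ nz_c).
by rewrite oner_eq0.
Qed.

(** By applying the generation property again to the coefficients [h i], one pushes
    the remainder to higher and higher order.  The predicate [Delta] stands for
    computing modulo a monomial ideal, whose complement it is. *)
Lemma expansion_in_parameters (K : closedFieldType) (n s d k : nat)
    (Delta : pred 'X_{1..n}) (gam : s.-tuple {mpoly K[n]}) (b : 'I_d -> {mpoly K[n]}) :
  (forall a c, Delta (a + c)%MM -> Delta a) ->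
  (forall i, (tnth gam i)@_0 = 0) ->
  (forall p, exists c : 'I_d -> K, exists h : 'I_s -> {mpoly K[n]},
     forall a, Delta a -> p@_a = (\sum_i c i *: b i + \sum_i h i * tnth gam i)@_a) ->
  forall p, exists q : 'I_d -> {mpoly K[s]}, (forall i, msize (q i) <= k)%N /\
    forall a, Delta a -> (mdeg a < k)%N -> p@_a = (\sum_i b i * (q i \mPo gam))@_a.
Proof.
move=> downD gam0 gen; elim: k => [|k IHk] p.
  by exists (fun=> 0); split=> // i; rewrite msize0.
have [c [h pE]] := gen p.
have /choice[q qP] j := IHk (h j).
exists (fun i => (c i)%:MP + \sum_j 'X_j * q j i); split=> [i|a Da lt_ak].
  rewrite (leq_trans (msizeD_le _ _)) // geq_max; apply/andP; split.
    by rewrite msizeC; case: (_ != 0).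
  rewrite (leq_trans (msize_sum _ _ _)) //; apply/bigmax_leqP => j _.
  have [-> | nz_q] := eqVneq (q j i) 0; first by rewrite mulr0 msize0.
  rewrite msizeM ?msizeX ?mdeg1 //; first by have [sz _] := qP j; apply: sz.
  by rewrite -msupp_eq0 msuppX.
(* The expansions of the [h j], multiplied by the [tnth gam j], have to be
   collected into one expansion. *)
rewrite pE // !mcoeffD.
have -> : \sum_i b i * (((c i)%:MP + \sum_j 'X_j * q j i) \mPo gam) =
    \sum_i c i *: b i + \sum_j (\sum_i b i * (q j i \mPo gam)) * tnth gam j.
  under [X in _ = _ + X]eq_bigr do rewrite mulr_suml.
  rewrite exchange_big -big_split /=; apply: eq_bigr => i _.
  rewrite comp_mpolyD comp_mpolyC mulrDr [b i * _]mulrC mul_mpolyC; congr (_ + _).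
  rewrite [X in b i * X]raddf_sum mulr_sumr; apply: eq_bigr => j _ /=.
  by rewrite rmorphM /= comp_mpolyXU -tnth_nth -mulrA; congr (_ * _); rewrite mulrC.
rewrite mcoeffD; congr (_ + _); rewrite !raddf_sum; apply: eq_bigr => j _ /=.
apply: mcoeffM_congr => e1 e2 eq_a.
have [->|nz_e2] := eqVneq e2 0%MM; first by rewrite gam0 !mulr0.
congr (_ * _); have [_] := qP j; apply; first by apply: (downD _ e2); rewrite -eq_a.
rewrite -ltnS (leq_trans _ lt_ak) // eq_a mdegD.
by rewrite ltnS -[X in (X < _)%N]addn0 ltn_add2l lt0n mdeg_eq0.
Qed.

(** Finite codimension, expressed with polynomials in place of power series: looking
    only at monomials in [I] of degree below [E] amounts to setting the other
    variables to zero and cutting off at order [E]. *)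
Definition truncated_generation (K : closedFieldType) (n s d E : nat)
    (I : {set 'I_n}) (gam : s.-tuple {mpoly K[n]}) : Prop :=
  exists b : 'I_d -> {mpoly K[n]}, forall p : {mpoly K[n]},
  exists c : 'I_d -> K, exists h : 'I_s -> {mpoly K[n]},
    forall a, mnm_in I a && (mdeg a < E)%N ->
      p@_a = (\sum_i c i *: b i + \sum_i h i * tnth gam i)@_a.

(** Krull's height theorem for the maximal ideal, by comparing dimensions: there are
    e^|I| monomials in [I] with exponents below [e], and modulo degree [E] they lie
    in the span of the products of the [b i] with monomials of degree below [E] in
    the [tnth gam i], of which there are at most d * E^s. *)
Lemma leq_card_parameters (K : closedFieldType) (n s d : nat) (I : {set 'I_n})
    (gam : s.-tuple {mpoly K[n]}) :
  (forall i, (tnth gam i)@_0 = 0) ->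
  (forall E, truncated_generation d E I gam) -> (#|I| <= s)%N.
Proof.
move=> gam0 gen; rewrite leqNgt; apply/negP => lt_sI.
have [e e_gt0 lt_e] := @exists_expn_gt #|I| s n.+1 d lt_sI.
(* The monomials in question have degree at most n * e, which is less than
   [E]. *)
set E := (e * n.+1)%N in lt_e; have [b bP] := gen E.
pose phi (t : {ffun {i | i \in I} -> 'I_e}) : 'X_{1..n} :=
  [multinom oapp (fun k => val (t k)) 0%N (insub i) | i < n].
have phi_inj : injective phi.
  move=> t t' /mnmP eq_tt'; apply/ffunP => k; apply: val_inj.
  by have := eq_tt' (val k); rewrite !mnmE valK.
have phiP t : mnm_in I (phi t) && (mdeg (phi t) < E)%N.
  apply/andP; split; first by apply/mnm_inP => i iI; rewrite mnmE insubN.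
  rewrite mdegE; apply: (@leq_ltn_trans (\sum_(i < n) e)%N).
    apply: leq_sum => i _; rewrite mnmE; case: insub => //= k.
    by rewrite ltnW.
  by rewrite sum_nat_const card_ord mulnC ltn_pmul2l.
have [|c [t0 nz_c] c0] := @linear_relation K ('I_d * {ffun 'I_s -> 'I_E})%type
    {ffun {i | i \in I} -> 'I_e}
    (fun t ia => (b ia.1 * ('X_[box_mnm ia.2] \mPo gam))@_(phi t)).
  by rewrite card_prod !card_ffun card_sig !card_ord.
have [|q [szq qP]] := @expansion_in_parameters K n s d E
    (fun a => mnm_in I a && (mdeg a < E)%N) gam b _ gam0 bP 'X_[phi t0].
  move=> a1 a2 /andP[/mnm_inP aI lt_aE]; apply/andP; split.
    by apply/mnm_inP => i /aI /eqP; rewrite mnmDE addn_eq0 => /andP[/eqP].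
  by apply: leq_ltn_trans lt_aE; rewrite mdegD leq_addr.
(* The linear form c kills the span of all products, hence every polynomial;
   but its value on the monomial of index [t0] is [c t0]. *)
case/eqP: nz_c; transitivity (\sum_t c t * ('X_[phi t0] : {mpoly K[n]})@_(phi t)).
  rewrite (bigD1 t0) //= mcoeffX eqxx mulr1 big1 ?addr0 // => t ne_t.
  by rewrite mcoeffX (inj_eq phi_inj) eq_sym (negPf ne_t) mulr0.
under eq_bigr => t _.
  have [_ lt_E] := andP (phiP t); rewrite (qP _ (phiP t) lt_E) raddf_sum mulr_sumr /=; over.
rewrite exchange_big big1 // => i _ /=.
under eq_bigr do rewrite comp_mpolyEX mulr_sumr raddf_sum mulr_sumr /=.
rewrite exchange_big big_seq big1 // => m qm /=.
have [k|al ->] := @box_mnmP s E m.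
  exact: leq_ltn_trans (mnm_le_mdeg _ _) (leq_trans (msize_mdeg_lt qm) (szq i)).
under eq_bigr do rewrite -scalerAr mcoeffZ mulrCA.
by rewrite -mulr_sumr (c0 (i, al)) mulr0.
Qed.

(** Setting the variables outside [I] to zero keeps the quotient finite-dimensional,
    and it kills the generators whose restriction vanishes. *)
Lemma leq_card_nonzero_restr (K : closedFieldType) (n r d : nat)
    (g : 'I_r -> {mpoly K[n]}) (I : {set 'I_n}) :
  ps_quotient_dim g d -> (0 < d)%N ->
  (#|I| <= #|[set j | restr I (g j) != 0%R]%SET|)%N.
Proof.
move=> gd d_gt0; set N := [set j | restr I (g j) != 0%R]%SET.
pose gam := [tuple g (enum_val k) | k < #|N|].
apply: (@leq_card_parameters K n #|N| d I gam) => [k|E].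
  by rewrite tnth_mktuple; apply: ps_quotient_dim_mcoeff0 gd d_gt0.
have [b [_ gen]] := gd; exists (fun i => truncate E (b i)) => p.
have [c [h ph]] := gen (fun a => p@_a).
exists c, (fun k => truncate E (h (enum_val k))) => a /andP[/mnm_inP aI lt_aE].
rewrite mcoeffD; apply/eqP; rewrite addrC -subr_eq; apply/eqP.
have -> : (\sum_i c i *: truncate E (b i))@_a = \sum_i c i * b i a.
  by rewrite raddf_sum; apply: eq_bigr => i _ /=; rewrite mcoeffZ mcoeff_truncate.
rewrite ph; transitivity (\sum_(j in N) (truncate E (h j) * g j)@_a).
  rewrite (bigID (mem N)) /= [X in _ + X]big1 ?addr0 => [|j jN].
    apply: eq_bigr => j _; apply: ps_mul_mcoeff => e1 e2 eq_a.
    by rewrite mcoeff_truncate // (leq_ltn_trans _ lt_aE) // eq_a mdegD leq_addr.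
  rewrite (ps_mul_mcoeff (p := truncate E (h j)) (q := g j)) => [|e1 e2 eq_a]; last first.
    by rewrite mcoeff_truncate // (leq_ltn_trans _ lt_aE) // eq_a mdegD leq_addr.
  apply: mcoeffM_eq0 => e1 e2 eq_a; rewrite [(g j)@_e2](_ : _ = 0) ?mulr0 //.
  have e2I : mnm_in I e2.
    by apply/mnm_inP => i /aI /eqP; rewrite eq_a mnmDE addn_eq0 => /andP[_ /eqP].
  have := mcoeff_restr I (g j) e2; rewrite e2I => <-.
  by move: jN; rewrite inE negbK => /eqP ->; rewrite mcoeff0.
rewrite big_enum_val raddf_sum; apply: eq_bigr => k _ /=.
by rewrite tnth_mktuple.
Qed.

(** * Newton diagrams and coordinate subspaces *)

Lemma dotDr (R : realType) (n : nat) (u y z : 'rV[R]_n) :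
  dot u (y + z) = dot u y + dot u z.
Proof. by rewrite -big_split; apply: eq_bigr => i _; rewrite mxE mulrDr. Qed.

Lemma dot0r (R : realType) (n : nat) (u : 'rV[R]_n) : dot u 0 = 0.
Proof. by apply: big1 => i _; rewrite mxE mulr0. Qed.

(** These weights separate exponents with entries below [T], and they make an exponent
    of this kind smaller than any exponent outside [I] as soon as it lies in [I]. *)
Definition dominant_weight (n T : nat) (I : {set 'I_n}) (i : 'I_n) : nat :=
  if i \in I then (T ^ i)%N else (T ^ (n + i))%N.

Definition dominant_degree (n T : nat) (I : {set 'I_n}) (a : 'X_{1..n}) : nat :=
  (\sum_i a i * dominant_weight T I i)%N.

Lemma dominant_degreeE (n T : nat) (I : {set 'I_n}) (a : 'X_{1..n}) :
  dominant_degree T I a =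
  ((\sum_i (if i \in I then a i else 0) * T ^ i)
   + (\sum_i (if i \in I then 0 else a i) * T ^ i) * T ^ n)%N.
Proof.
rewrite big_distrl -big_split /=; apply: eq_bigr => i _; rewrite /dominant_weight.
by case: ifP; rewrite ?mul0n ?addn0 // add0n -mulnA -expnD addnC.
Qed.

Lemma dominant_degree_inj (n T : nat) (I : {set 'I_n}) (a b : 'X_{1..n}) :
  (forall i, a i < T)%N -> (forall i, b i < T)%N ->
  dominant_degree T I a = dominant_degree T I b -> a = b.
Proof.
move=> ltaT ltbT; rewrite !dominant_degreeE => eq_ab.
have lt_if c (P : pred 'I_n) i : (c < T)%N -> ((if P i then c else 0) < T)%N.
  by case: ifP => // _; apply: leq_ltn_trans.
have lt_fi c (P : pred 'I_n) i : (c < T)%N -> ((if P i then 0 else c) < T)%N.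
  by case: ifP => // _; apply: leq_ltn_trans.
have ltI (c : 'X_{1..n}) : (forall i, c i < T)%N ->
    (\sum_i (if i \in I then c i else 0) * T ^ i < T ^ n)%N.
  by move=> lt_cT; apply: digits_lt => i; apply: (lt_if _ (mem I)).
have Tn_gt0 : (0 < T ^ n)%N := leq_ltn_trans (leq0n _) (ltI a ltaT).
have eq_out := congr1 (fun z => z %/ T ^ n)%N eq_ab.
rewrite ![(_ + _ * T ^ n)%N]addnC !divnMDl // !divn_small ?ltI // !addn0 in eq_out.
move: eq_ab; rewrite eq_out => /addIn eq_in.
have {}eq_in := digits_inj (fun i => lt_if (a i) (mem I) i (ltaT i))
  (fun i => lt_if (b i) (mem I) i (ltbT i)) eq_in.
have {}eq_out := digits_inj (fun i => lt_fi (a i) (mem I) i (ltaT i))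
  (fun i => lt_fi (b i) (mem I) i (ltbT i)) eq_out.
by apply/mnmP => i; have := eq_in i; have /= := eq_out i; case: ifP.
Qed.

Lemma dominant_degree_mnm_in (n T : nat) (I : {set 'I_n}) (a b : 'X_{1..n}) :
  (forall i, a i < T)%N -> mnm_in I a ->
  (dominant_degree T I b <= dominant_degree T I a)%N -> mnm_in I b.
Proof.
move=> ltaT /mnm_inP aI le_ba; apply/mnm_inP => i iI; apply/eqP; rewrite -leqn0 leqNgt.
apply/negP => b_gt0.
have aE : dominant_degree T I a = (\sum_i a i * T ^ i)%N.
  by apply: eq_bigr => k _; rewrite /dominant_weight; case: ifPn => // /aI ->.
suff : (T ^ n <= dominant_degree T I a)%N by rewrite aE leqNgt digits_lt.
apply: leq_trans le_ba; rewrite /dominant_degree (bigD1 i) //= /dominant_weight (negPf iI).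
apply: leq_trans (leq_addr _ _); rewrite expnD mulnCA leq_pmulr // muln_gt0 b_gt0.
by rewrite expn_gt0 (leq_ltn_trans _ (ltaT i)).
Qed.

(** A weight vector with positive entries that is minimal at a single exponent [a]
    cuts out the compact face consisting of [a] alone, which thus lies on the
    diagram. *)
Lemma dominant_face (R : realType) (K : closedFieldType) (n : nat)
    (g : {mpoly K[n]}) (I : {set 'I_n}) :
  restr I g != 0 ->
  exists2 a, mnm_in I a & newton_diagram R g (exponent R a).
Proof.
move=> /restr_neq0[a1 ga1 a1I]; pose T := msize g.
have lt_T b : b \in msupp g -> forall i, (b i < T)%N.
  by move=> gb i; apply: leq_ltn_trans (mnm_le_mdeg _ _) (msize_mdeg_lt gb).
pose deg (b : 'X_{1..n}) := (dominant_degree T I b)%:Z.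
have [|a ga /allP mina] := @exists_minimal _ deg (msupp g).
  by apply: contraTneq ga1 => ->.
have aI : mnm_in I a.
  by apply: dominant_degree_mnm_in (lt_T _ ga1) a1I _;
     have := mina _ ga1; rewrite lez_nat.
exists a => //; pose u : 'rV[R]_n := \row_i (dominant_weight T I i)%:R.
have u_gt0 i : 0 < u 0 i.
  by rewrite mxE ltr0n /dominant_weight; case: ifP;
     rewrite expn_gt0 (leq_ltn_trans _ (lt_T _ ga i)).
have dotu b : dot u (exponent R b) = (dominant_degree T I b)%:R.
  by rewrite natr_sum; apply: eq_bigr => i _; rewrite !mxE natrM mulrC.
have y_ge0 y : orthant R n y -> 0 <= dot u y.
  by move=> y0; apply: sumr_ge0 => i _; rewrite mulr_ge0 // ltW.
have ge_a s : (exponent R @` [set b | b \in msupp g]) s -> dot u (exponent R a) <= dot u s.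
  by move=> [b gb <-]; rewrite !dotu ler_nat; have := mina _ gb; rewrite lez_nat.
have z_ge z : newton_polytope R g z -> dot u (exponent R a) <= dot u z.
  exact: convex_hull_dot_ge.
pose Q := [set y + z | y in orthant R n & z in newton_polytope R g].
have Qa : Q (exponent R a).
  exists 0; first by move=> i; rewrite mxE.
  by exists (exponent R a); [apply: exponent_newton_polytope | rewrite add0r].
suff faceE : face u Q = [set exponent R a].
  by exists u; rewrite /= faceE; split=> //; apply: compact_set1.
apply/seteqP; split=> [x [[y y0 [z Qz <-{x}]] leyz]|_ ->]; last first.
  split=> // _ [y y0 [z Qz <-]]; rewrite dotDr.
  by rewrite -[leLHS]add0r lerD ?y_ge0 ?z_ge.
have := leyz _ Qa; rewrite dotDr => le_yz.
have y_eq0 : y = 0.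
  have /eqP : dot u y = 0.
    apply/le_anti; rewrite y_ge0 // andbT -(lerD2r (dot u z)) add0r.
    by apply: le_trans le_yz _; apply: z_ge.
  rewrite psumr_eq0 => [/allP h|i _]; last by rewrite mulr_ge0 ?y0 // ltW.
  apply/rowP => i; have := h i (mem_index_enum _); rewrite /= mulf_eq0 gt_eqF //= mxE.
  by move/eqP.
move: le_yz; rewrite y_eq0 dot0r !add0r => le_za {y y0 y_eq0 leyz}.
have [k [p [l [Sp l_ge0 l1 zE]]]] := Qz.
rewrite zE -[exponent R a]scale1r -l1 scaler_suml; apply: eq_bigr => i _.
have dot0 : \sum_i l i * (dot u (p i) - dot u (exponent R a)) = 0.
  apply/le_anti/andP; split; last first.
    by apply: sumr_ge0 => j _; rewrite mulr_ge0 // subr_ge0 ge_a.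
  under eq_bigr do rewrite mulrBr; rewrite sumrB -mulr_suml l1 mul1r subr_le0.
  by apply: le_trans le_za; rewrite zE dot_sumr ler_sum // => j _; rewrite dotZr.
have /eqP := dot0; rewrite psumr_eq0 => [/allP/(_ i (mem_index_enum _))/=|j _]; last first.
  by rewrite mulr_ge0 // subr_ge0 ge_a.
rewrite mulf_eq0 => /orP[/eqP->|]; first by rewrite !scale0r.
have [b gb <-] := Sp i; rewrite !dotu subr_eq0 eqr_nat => /eqP eq_ba.
by rewrite (dominant_degree_inj (lt_T _ gb) (lt_T _ ga) eq_ba).
Qed.

Lemma diagram_coord_space (R : realType) (n : nat) (A : {fset 'X_{1..n}})
    (I : {set 'I_n}) (x : 'rV[R]_n) :
  diagram_of_polytope (hull_of R A) x -> coord_space R I x ->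
  exists2 a, a \in A & mnm_in I a.
Proof.
move=> [u [_ [[y y0 [z Az <-]] _]]] xI; apply: convex_hull_coord_space (Az) _ => i iI.
have z0 : 0 <= z 0 i.
  have dotE s : dot (delta_mx 0 i) s = s 0 i :> R.
    rewrite /dot (bigD1 i) //= mxE !eqxx mul1r big1 ?addr0 // => k /negPf ne_k.
    by rewrite mxE ne_k mul0r.
  rewrite -dotE; apply: convex_hull_dot_ge Az => _ [b _ <-].
  by rewrite dotE mxE ler0n.
by have /eqP := xI i iI; rewrite mxE paddr_eq0 // => /andP[_ /eqP].
Qed.

(** The multiplicity supplies a tuple [g] with the same diagrams that generates a
    proper ideal of finite codimension; the count of its non-zero restrictions
    carries over to [f]. *)
Lemma totally_nondegenerate_diagram (R : realType) (K : closedFieldType) (n d : nat)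
    (A : 'I_n -> {fset 'X_{1..n}}) (f : 'I_n -> {mpoly K[n]}) :
  let G := fun j => diagram_of_polytope (hull_of R (A j)) in
  (forall j, msupp (f j) =i A j) -> totally_nondegenerate f ->
  (0 < d)%N -> diagram_mult K G d -> diagram_nondegenerate G f.
Proof.
move=> G suppf ndg d_gt0 [[g gG gd] _]; split=> [j|I v I_gt0 [[vI _] v_gt0] [x nz_x fx0]].
  by rewrite /newton_diagram (newton_polytope_hull R (suppf j)).
have leI : (#|I| <= #|[set j | restr I (f j) != 0%R]%SET|)%N.
  apply: leq_trans (leq_card_nonzero_restr I gd d_gt0) _.
  apply/subset_leq_card/fintype.subsetP => j;
  rewrite !inE => nzg; have [a aI] := dominant_face R nzg.
  rewrite gG => Ga; have [|b Ab bI] := diagram_coord_space (I := I) Ga.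
    by move=> i iI; rewrite mxE (mnm_inP _ _ aI).
  by apply/restr_neq0; exists b; rewrite ?suppf.
have nz_v : v != 0.
  have /card_gt0P[i /v_gt0 vi] := I_gt0.
  by apply: contraTneq vi => ->; rewrite mxE ltxx.
have nz i : x i != 0 by rewrite nz_x inE.
by apply: (nonzero_weight_no_zero ndg vI nz_v leI nz) => j; apply: fx0; rewrite inE.
Qed.

Theorem corollaryA4 (R : realType) (K : closedFieldType) (n : nat)
    (hn : (0 < n)%N) :
  (forall (m : nat) (A : 'I_m -> {fset 'X_{1..n}}), (0 < m)%N ->
     exists U : set ('I_m -> {mpoly K[n]}),
       [/\ zariski_open A U, U !=set0
         & forall f, U f -> completely_BKK_on_affine R f])
  /\
  (forall A : 'I_n -> {fset 'X_{1..n}},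
     let P := fun j => convex_hull (exponent R @` [set a | a \in A j]) in
     let G := fun j => diagram_of_polytope (P j) in
     exists U : set ('I_n -> {mpoly K[n]}),
       [/\ zariski_open A U, U !=set0,
           forall f, U f -> completely_BKK_on_affine R f,
           forall f, U f -> polytope_nondegenerate P f
         & (exists2 d : nat, (0 < d)%N & diagram_mult K G d) ->
           forall f, U f -> diagram_nondegenerate G f]).
Proof.
split=> [m A _|A P G].
  have [U [openU U0 _ ndg]] := exists_nondegenerate_open K A.
  by exists U; split=> // f /ndg; apply: totally_nondegenerate_BKK.
have [U [openU U0 suppU ndg]] := exists_nondegenerate_open K A.
exists U; split=> // [f /ndg|f Uf|[d d_gt0 Gd] f Uf].
- exact: totally_nondegenerate_BKK.
- exact: totally_nondegenerate_polytope (suppU f Uf) (ndg f Uf).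
- exact: totally_nondegenerate_diagram (suppU f Uf) (ndg f Uf) d_gt0 Gd.
Qed.
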